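(* Let $Z=Z(\boldsymbol\sigma,X,Y)$ be a bi-parameter Haar system Hardy space and suppose that at least one of the following holds: (1) $(\sigma^{(1)}_I)$ is constant and either $\|\cdot\|_X\sim\|\cdot\|_{L^1}$ or $\|\cdot\|_X\sim\|\cdot\|_{L^\infty}$; (2) $(\sigma^{(2)}_J)$ is constant and either $\|\cdot\|_Y\sim\|\cdot\|_{L^1}$ or $\|\cdot\|_Y\sim\|\cdot\|_{L^\infty}$. Then the Capon projection $\mathcal C:Z\to Z$ is unbounded.
   Context: Haar functions. $\mathcal D$ is the set of dyadic intervals $[\frac{i-1}{2^j},\frac{i}{2^j})$, $j\ge 0$, $1\le i\le 2^j$. For $I\in\mathcal D$, $I^+$ and $I^-$ are its left and right halves and $h_I=\chi_{I^+}-\chi_{I^-}$; $(k_J)$ is a copy of $(h_I)$. $(h_I\otimes k_J)(s,t)=h_I(s)k_J(t)$, and $\mathcal V(\delta^2)$ is the linear span of all $h_I\otimes k_J$. $\mathcal V_1(\delta)=\mathrm{span}\{\chi_I:I\in\mathcal D\}$. Haar system spaces. A Haar system space is the completion of $\mathcal V_1(\delta)$ under a norm $\|\cdot\|$ such that $\|f\|=\|g\|$ whenever $|f|,|g|$ have the same distribution, and $\|\chi_{[0,1)}\|=1$. The class of these is $\mathcal H(\delta)$. Haar system Hardy spaces. Let $\boldsymbol\sigma$ be one of the four product sets $S_1\times S_2$ with $S_1,S_2\in\{\{1\}^{\mathcal D},\{\pm1\}^{\mathcal D}\}$, and let $\mathbb E$ be the expectation with respect to the Haar (uniform product) probability measure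 over $((\sigma^{(1)}_I)_{I\in\mathcal D},(\sigma^{(2)}_J)_{J\in\mathcal D})\in\boldsymbol\sigma$. ''$(\sigma^{(i)})$ is constant'' means $S_i=\{1\}^{\mathcal D}$. For $X,Y\in\mathcal H(\delta)$, $Z(\boldsymbol\sigma,X,Y)$ is the completion of $\mathcal V(\delta^2)$ under the norm, for $f=\sum_{I,J}a_{I,J}h_I\otimes k_J$, $$\|f\|_Z=\Big\|s\mapsto\Big\|t\mapsto\mathbb E\Big|\sum_{I,J}\sigma^{(1)}_I\sigma^{(2)}_Ja_{I,J}h_I(s)k_J(t)\Big|\Big\|_Y\Big\|_X.$$ $\|\cdot\|_X\sim\|\cdot\|_{L^1}$ means that the two norms are equivalent on $\mathcal V_1(\delta)$, and similarly for the others. The Capon projection $\mathcal C:\mathcal V(\delta^2)\to\mathcal V(\delta^2)$ is the linear map with $\mathcal C(h_I\otimes k_J)=h_I\otimes k_J$ if $|I|\le|J|$ and $\mathcal C(h_I\otimes k_J)=0$ if $|I|>|J|$. It is unbounded on $Z$ if $\sup\{\|\mathcal Cf\|_Z:f\in\mathcal V(\delta^2),\|f\|_Z\le1\}=\infty$. *)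

(* Defs.v *)
From HB Require Import structures.
From mathcomp Require Import all_boot all_order all_algebra.
From mathcomp Require Import all_classical all_reals all_analysis.

Set Implicit Arguments.
Unset Strict Implicit.
Unset Printing Implicit Defensive.

Import Order.TTheory GRing.Theory Num.Theory.
Import numFieldNormedType.Exports.

Local Open Scope classical_set_scope.
Local Open Scope ring_scope.

(* The pair (j, i), with i < 2 ^ j counted from 0, stands for the interval
   [i / 2 ^ j, (i + 1) / 2 ^ j). *)
Definition dyadic := {j : nat & 'I_(2 ^ j)}.

Section Haar.
Context {R : realType}.
Implicit Types (I J : dyadic) (f g : R -> R).

Definition dyadic_itv (j i : nat) : set R :=
  [set` `[i%:R / 2 ^+ j, i.+1%:R / 2 ^+ j[].

Definition dset I : set R := dyadic_itv (tag I) (tagged I).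

Definition dlen I : R := (2 ^+ tag I)^-1.

Definition dleft I : set R := dyadic_itv (tag I).+1 (tagged I).*2.

Definition dright I : set R := dyadic_itv (tag I).+1 (tagged I).*2.+1.

Definition haar I (s : R) : R := \1_(dleft I) s - \1_(dright I) s.

(* Functions on [0, 1) are represented by functions on R; those in the span
   below vanish outside [0, 1). *)
Definition V1 : set (R -> R) :=
  [set f | exists r : seq (R * dyadic),
     f = fun s => \sum_(p <- r) p.1 * \1_(dset p.2) s].

(* Lebesgue measure on [0, 1). *)
Definition leb01 : {measure set (measurableTypeR R) -> \bar R} :=
  mrestr lebesgue_measure (measurable_itv `[0%R, 1%R[).

Definition same_abs_distribution f g : Prop :=
  forall B : set (measurableTypeR R), measurable B ->
    leb01 ((fun s => `|f s|) @^-1` B) = leb01 ((fun s => `|g s|) @^-1` B).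

End Haar.

(* The completion of V1 is determined by the norm, so only the norm is recorded;
   its values outside V1 are irrelevant. *)
Record haar_system_space (R : realType) := HaarSystemSpace {
  hss_norm :> (R -> R) -> R ;
  hss_definite : forall f, V1 f -> hss_norm f = 0 -> f = cst 0 ;
  hss_scale : forall (c : R) f, V1 f ->
    hss_norm (fun s => c * f s) = `|c| * hss_norm f ;
  hss_triangle : forall f g, V1 f -> V1 g ->
    hss_norm (fun s => f s + g s) <= hss_norm f + hss_norm g ;
  hss_invariant : forall f g, V1 f -> V1 g ->
    same_abs_distribution f g -> hss_norm f = hss_norm g ;
  hss_normalized : hss_norm \1_([set` `[0%R, 1%R[] : set R) = 1 }.

Definition equiv_Lp (R : realType) (X : haar_system_space R) (p : \bar R) :=
  exists c C : R, [/\ 0 < c, 0 < C &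
    forall f, V1 f ->
      (c%:E * 'N[leb01]_p[EFin \o f] <= (X f)%:E <=
       C%:E * 'N[leb01]_p[EFin \o f])%E].

(* The group {+1, -1}^D, in which b : bool encodes the sign (-1) ^ b, with the
   product sigma-algebra. *)
Definition sign_coord : set (set (dyadic -> bool)) :=
  [set A | exists I b, A = [set w | w I = b]].

Definition signs := g_sigma_algebraType sign_coord.

Definition sign_of (R : realType) (w : signs) (I : dyadic) : R :=
  (-1) ^+ (w I : bool).

(* The uniform law of one coordinate of S, where S = {+1}^D if c = true and
   S = {+1, -1}^D if c = false. *)
Definition coord_law (R : realType) (c b : bool) : R :=
  if c then (~~ b)%:R else 2^-1.

(* The values on cylinders determine P, as the cylinders form a pi-system
   generating the sigma-algebra. *)
Definition is_haar_measure (R : realType) (c1 c2 : bool)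
    (P : probability (signs * signs)%type R) : Prop :=
  forall (F1 F2 : seq dyadic) (e1 e2 : dyadic -> bool), uniq F1 -> uniq F2 ->
    P [set w | {in F1, forall I, (w.1 : signs) I = e1 I} /\
               {in F2, forall J, (w.2 : signs) J = e2 J}] =
    ((\prod_(I <- F1) coord_law R c1 (e1 I)) *
     (\prod_(J <- F2) coord_law R c2 (e2 J)))%:E.

(* The tensors h_I (x) k_J are linearly independent, so an element of their span
   is given by its finitely supported array of coefficients. *)
Definition V2 (R : realType) : set (dyadic * dyadic -> R) :=
  [set a | finite_set [set p | a p != 0]].
Arguments V2 : clear implicits.

Definition haar_sum (R : realType) (a : dyadic * dyadic -> R) (s t : R) : R :=
  \sum_(p \in [set: dyadic * dyadic]) a p * (haar p.1 s * haar p.2 t).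

Definition Z_norm (R : realType) (P : probability (signs * signs)%type R)
    (X Y : haar_system_space R) (a : dyadic * dyadic -> R) : R :=
  X (fun s => Y (fun t => fine
    'E_P[fun w => `|haar_sum
           (fun p => sign_of R w.1 p.1 * sign_of R w.2 p.2 * a p) s t|])).

Definition capon (R : realType) (a : dyadic * dyadic -> R) :
    dyadic * dyadic -> R :=
  fun p => if dlen p.1 <= dlen p.2 :> R then a p else 0.

Definition capon_unbounded (R : realType)
    (P : probability (signs * signs)%type R) (X Y : haar_system_space R) : Prop :=
  ereal_sup [set (Z_norm P X Y (capon a))%:E |
             a in [set a | V2 R a /\ Z_norm P X Y a <= 1]] = +oo%E.

(* Main.v *)
Require Import Defs.
From mathcomp Require Import all_boot all_order all_algebra.
From mathcomp Require Import all_classical all_reals all_analysis.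
From mathcomp Require Import measurable_realfun ess_sup_inf.
From mathcomp Require Import ring lra zify.

Set Implicit Arguments.
Unset Strict Implicit.
Unset Printing Implicit Defensive.

Import Order.TTheory GRing.Theory Num.Theory.
Local Open Scope classical_set_scope.
Local Open Scope ring_scope.

(** Call x the variable whose signs are constant and whose space is equivalent
    to L^1 or L^oo, and y the other one. In x only the Haar functions h_l of
    [0, 2^-l) are used, and every rearrangement invariant norm lies between
    those of L^1 and L^oo.

    If the space of x is L^1, take f(x, y) = g(x) w(y), with g the sum of
    2^l h_l, whose L^1 norm is at most 2, and w a Rademacher walk stopped on
    leaving [-K, K]; then f has norm O(K). For x in [2^-(k+1), 2^-k) the level k
    (or k - 1) component of w enters C f with a coefficient of order 2^k, so
    integrating over x bounds the norm of C f below by a multiple of the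
    expected lifetime of the walk up to time K^2, which is of order K^2.

    If the space of x is L^oo, take f to be the sum over m of r_m(y) times the
    centred indicator of [2^-(m+1), 2^-m) (or of the next block). These blocks
    are disjoint, so f is bounded by 2, whereas at x = 0 the function C f is a
    sum of K^2 Rademacher functions with coefficients bounded below; pairing it
    with the stopped walk shows that its L^1 norm is of order K. *)

(** * Finite Haar sums as dyadic walks *)

Section HaarWalk.
Context {R : realFieldType}.
Implicit Types (s u v w : nat -> nat -> R) (c q : nat -> R) (M : R).

Definition avg n (F : nat -> R) : R := (2 ^+ n)^-1 * \sum_(i < 2 ^ n) F i.

(* The value on the [i]-th interval of length [2 ^- n] of the Haar sum in which
   the [j]-th interval of length [2 ^- m] has coefficient [u m j]. *)
Definition hwalk u n i : R :=
  \sum_(m < n) u m (i %/ 2 ^ (n - m))%N * (-1) ^+ odd (i %/ 2 ^ (n - m.+1)).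

Lemma normr1_sqr (x : R) : `|x| = 1 -> x * x = 1.
Proof. by move=> x1; rewrite -expr2 -real_normK ?num_real// x1 expr1n. Qed.

Lemma hwalk0 u i : hwalk u 0 i = 0.
Proof. exact: big_ord0. Qed.

Lemma hwalkS u n i :
  hwalk u n.+1 i = hwalk u n i./2 + u n i./2 * (-1) ^+ odd i.
Proof.
rewrite /hwalk big_ord_recr /= subSnn subnn expn1 expn0 divn1 divn2.
congr (_ + _); apply: eq_bigr => m _.
by rewrite -divn2 -!divnMA -!expnS subSS (subnSK (ltn_ord m)) -subSn 1?ltnW.
Qed.

Lemma eq_hwalk u v n i : (forall m j, (m < n)%N -> u m j = v m j) ->
  hwalk u n i = hwalk v n i.
Proof. by move=> uv; apply: eq_bigr => m _; rewrite uv. Qed.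

Lemma hwalkZ a u n i : hwalk (fun m j => a * u m j) n i = a * hwalk u n i.
Proof. by rewrite /hwalk mulr_sumr; apply: eq_bigr => m _; rewrite mulrA. Qed.

Lemma le_abs_hwalk u n i :
  `|hwalk u n i| <= \sum_(m < n) `|u m (i %/ 2 ^ (n - m))%N|.
Proof.
apply: le_trans (ler_norm_sum _ _ _) _; apply: ler_sum => m _.
by rewrite normrM normr_sign mulr1.
Qed.

Lemma sum_pow2S (F : nat -> R) n :
  \sum_(i < 2 ^ n.+1) F i = \sum_(i < 2 ^ n) (F i.*2 + F i.*2.+1).
Proof.
rewrite expnS mul2n; elim: (2 ^ n)%N => [|k IH]; first by rewrite !big_ord0.
by rewrite doubleS !big_ord_recr/= IH addrA.
Qed.

Lemma avgS (F : nat -> R) n : avg n.+1 F = avg n (fun i => (F i.*2 + F i.*2.+1) / 2).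
Proof.
rewrite /avg sum_pow2S -mulr_suml exprS; field.
by rewrite expf_neq0// pnatr_eq0.
Qed.

Lemma pow2_gt0 n : 0 < 2 ^+ n :> R. Proof. by rewrite exprn_gt0. Qed.
#[local] Hint Resolve pow2_gt0 : core.

Lemma eq_avg n (F G : nat -> R) : (forall i, (i < 2 ^ n)%N -> F i = G i) ->
  avg n F = avg n G.
Proof. by move=> FG; congr (_ * _); apply: eq_bigr => i _; exact: FG. Qed.

Lemma le_avg n (F G : nat -> R) : (forall i, (i < 2 ^ n)%N -> F i <= G i) ->
  avg n F <= avg n G.
Proof.
by move=> FG; rewrite ler_pM2l ?invr_gt0//; apply: ler_sum => i _; exact: FG.
Qed.

Lemma avg_ge0 n (F : nat -> R) : (forall i, (i < 2 ^ n)%N -> 0 <= F i) ->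
  0 <= avg n F.
Proof.
move=> F0; apply: mulr_ge0; first by rewrite invr_ge0 ltW.
by apply: sumr_ge0 => i _; exact: F0.
Qed.

Lemma avg_cst n (a : R) : avg n (fun=> a) = a.
Proof.
rewrite /avg sumr_const card_ord -[a *+ _]mulr_natr natrX mulrCA mulVf ?mulr1//.
Qed.

Lemma avgD n (F G : nat -> R) : avg n (fun i => F i + G i) = avg n F + avg n G.
Proof. by rewrite /avg big_split mulrDr. Qed.

Lemma avgZ n a (F : nat -> R) : avg n (fun i => a * F i) = a * avg n F.
Proof. by rewrite /avg -mulr_sumr mulrCA. Qed.

Lemma ler_norm_avg n (F : nat -> R) : `|avg n F| <= avg n (fun i => `|F i|).
Proof.
rewrite normrM ger0_norm ?invr_ge0 ?(ltW (pow2_gt0 _))// ler_pM2l ?invr_gt0//.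
exact: ler_norm_sum.
Qed.

(** Orthogonality of the Haar functions: on the two halves of an interval the new increments are
    opposite, so the cross terms cancel in the mean and each level adds the product of its
    coefficients. *)
Lemma avg_hwalkM u v n :
  avg n (fun i => hwalk u n i * hwalk v n i) =
  \sum_(m < n) avg m (fun i => u m i * v m i).
Proof.
elim: n => [|n IH].
  rewrite big_ord0 -[RHS](avg_cst 0); apply: eq_avg => i _.
  by rewrite hwalk0 mul0r.
rewrite big_ord_recr /= -IH avgS -avgD; apply: eq_avg => i _.
by rewrite !hwalkS /= odd_double doubleK uphalf_double /=; field.
Qed.

(* Frozen on leaving [-M, M], hence bounded by [M + 1] when the steps [s] are signs. *)
Fixpoint stopped (M : R) (s : nat -> nat -> R) (n i : nat) : R :=
  if n is n'.+1 then
    let x := stopped M s n' i./2 in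
    x + (`|x| <= M)%R%:R * s n' i./2 * (-1) ^+ odd i
  else 0.

Definition alive M s m i : R := (`|stopped M s m i| <= M)%R%:R.

Lemma alive_ge0 M s m i : 0 <= alive M s m i.
Proof. exact: ler0n. Qed.

Lemma hwalk_stopped M s n i :
  hwalk (fun m j => alive M s m j * s m j) n i = stopped M s n i.
Proof. by elim: n i => [|n IH] i; rewrite ?hwalk0 // hwalkS IH. Qed.

Lemma stopped_bound M s n i : 0 <= M -> (forall m j, `|s m j| = 1) ->
  `|stopped M s n i| <= M + 1.
Proof.
move=> M0 s1; elim: n i => [|n IH] i /=; first by rewrite normr0; lra.
case: (leP `|stopped M s n i./2| M) => [xM|_].
  apply: le_trans (ler_normD _ _) _.
  by rewrite mul1r normrM s1 normr_sign mulr1 lerD2r.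
by rewrite !mul0r addr0.
Qed.

(** By orthogonality the second moment of the stopped walk at time m is its expected lifetime up to
    m, at most the lifetime T up to K^2. Chebyshev then bounds the probability of being alive at
    each m <= K^2 below by 1 - T / K^2; summing over m < K^2 gives K^2 - T <= T. *)
Lemma sum_alive (K n : nat) s : (forall m j, `|s m j| = 1) ->
  (0 < K)%N -> (K ^ 2 <= n)%N ->
  K%:R ^+ 2 / 2 <= \sum_(m < n) avg m (alive K%:R s m).
Proof.
move=> s1 K0 Kn; pose M : R := K%:R; rewrite -/M.
have M0 : 0 < M by rewrite ltr0n.
have sq m : avg m (fun i => stopped M s m i ^+ 2) =
    \sum_(k < m) avg k (alive M s k).
  have E k : avg k (alive M s k) =
      avg k (fun i => (alive M s k i * s k i) * (alive M s k i * s k i)).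
    apply: eq_avg => i _; rewrite /alive mulrACA.
    by rewrite (normr1_sqr (s1 k i)) mulr1 -natrM mulnb andbb.
  under eq_bigr do rewrite E.
  pose u k j := alive M s k j * s k j; rewrite -(avg_hwalkM u u).
  by apply: eq_avg => i _; rewrite hwalk_stopped expr2.
pose T := \sum_(m < K ^ 2) avg m (alive M s m).
have avg0 m : 0 <= avg m (alive M s m) by apply: avg_ge0 => i _; exact: alive_ge0.
have leT m : (m <= K ^ 2)%N -> \sum_(k < m) avg k (alive M s k) <= T.
  move=> mK; rewrite /T -(subnKC mK) big_split_ord /= lerDl sumr_ge0// => i _.
have Pm m : (m <= K ^ 2)%N -> 1 - T / M ^+ 2 <= avg m (alive M s m).
  move=> mK; rewrite lerBlDl -[leLHS](avg_cst m 1).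
  apply: le_trans (_ : avg m (fun i => (M ^+ 2)^-1 * stopped M s m i ^+ 2 +
                                       alive M s m i) <= _).
    apply: le_avg => i _; rewrite /alive; case: (leP `|stopped M s m i| M) => h.
      by rewrite lerDr mulr_ge0 ?invr_ge0 ?sqr_ge0.
    rewrite addr0 mulrC ler_pdivlMr ?exprn_gt0// mul1r.
    rewrite -[leRHS]real_normK ?num_real//.
    by rewrite ler_pXn2r ?nnegrE ?normr_ge0 ?(ltW M0)// ltW.
  by rewrite avgD avgZ sq lerD2r mulrC ler_pM2r ?invr_gt0 ?exprn_gt0// leT.
have : M ^+ 2 / 2 <= T.
  have : \sum_(m < K ^ 2) (1 - T / M ^+ 2) <= T.
    by apply: ler_sum => m _; apply: Pm; exact: ltnW.
  rewrite sumr_const card_ord -[_ *+ (K ^ 2)]mulr_natl natrX -/M mulrBr mulr1.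
  rewrite mulrCA divff ?expf_neq0 ?gt_eqF// mulr1; lra.
move=> /le_trans; apply; rewrite /T -(subnKC Kn) big_split_ord /= lerDl.
exact: sumr_ge0.
Qed.

(* Pair the walk with the bounded function [w m0 * s m0], a Haar sum of a single level. *)
Lemma avg_hwalk_ge_level q w s n m0 : (m0 < n)%N ->
  (forall m j, `|s m j| = 1) -> (forall m j, (w m j == 0) || (w m j == 1)) ->
  `|q m0| * avg m0 (w m0) <=
  avg n (fun i => `|hwalk (fun m j => s m j * (q m * w m j)) n i|).
Proof.
move=> m0n s1 w01.
pose v m j := (m == m0)%:R * (s m j * w m j).
have v1 i : `|hwalk v n i| <= 1.
  apply: le_trans (le_abs_hwalk _ _ _) _.
  rewrite (bigD1 (Ordinal m0n))//= big1 ?addr0.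
    rewrite /v eqxx mul1r normrM s1 mul1r.
    by have /orP[/eqP->|/eqP->] := w01 m0 (i %/ 2 ^ (n - m0))%N;
      rewrite ?normr0 ?normr1.
  by move=> m; rewrite /v -val_eqE /= => /negbTE->; rewrite mul0r normr0.
have -> : `|q m0| * avg m0 (w m0) =
   `|avg n (fun i => hwalk (fun m j => s m j * (q m * w m j)) n i * hwalk v n i)|.
  rewrite avg_hwalkM (bigD1 (Ordinal m0n))//= big1 ?addr0; last first.
    move=> m; rewrite -val_eqE /= => /negbTE mm0; rewrite -[RHS](avg_cst m 0).
    by apply: eq_avg => i _; rewrite /v mm0 mul0r mulr0.
  have -> : avg m0 (fun i => s m0 i * (q m0 * w m0 i) * v m0 i) =
      q m0 * avg m0 (w m0).
    rewrite -avgZ; apply: eq_avg => i _; rewrite /v eqxx mul1r mulrACA.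
    rewrite normr1_sqr ?s1// mul1r.
    by have /orP[/eqP->|/eqP->] := w01 m0 i; ring.
  rewrite [RHS]normrM; congr (_ * _); rewrite ger0_norm//; apply: avg_ge0 => i _.
  by have /orP[/eqP->|/eqP->] := w01 m0 i.
apply: le_trans (ler_norm_avg _ _) _; apply: le_avg => i _.
by rewrite normrM ler_piMr.
Qed.

(** Duality with the stopped walk, which is bounded by K + 1. The pairing is the lifetime weighted
    by [q], hence at least a quarter of the K^2 / 2 from [sum_alive]. *)
Lemma avg_hwalk_ge_stopped q s (K n : nat) : (0 < K)%N -> (K ^ 2 <= n)%N ->
  (forall m j, `|s m j| = 1) -> (forall m, 0 <= q m) ->
  (forall m, (m < K ^ 2)%N -> 4^-1 <= q m) ->
  K%:R ^+ 2 / 8 <=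
  (K%:R + 1) * avg n (fun i => `|hwalk (fun m j => s m j * q m) n i|).
Proof.
move=> K0 Kn s1 q0 q4; pose M : R := K%:R; rewrite -/M.
have M0 : 0 <= M by rewrite ler0n.
apply: (@le_trans _ _
   `|avg n (fun i => hwalk (fun m j => s m j * q m) n i * stopped M s n i)|).
  rewrite (@eq_avg _ _ (fun i => hwalk (fun m j => s m j * q m) n i *
      hwalk (fun m j => alive M s m j * s m j) n i)); last first.
    by move=> i _; rewrite hwalk_stopped.
  rewrite avg_hwalkM; apply: le_trans (ler_norm _).
  have E m : avg m (fun i => s m i * q m * (alive M s m i * s m i)) =
      q m * avg m (alive M s m).
    rewrite -avgZ; apply: eq_avg => i _.
    rewrite [s m i * _]mulrC [alive _ _ _ _ * _]mulrC mulrA -[_ * s m i * s m i]mulrA.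
    by rewrite normr1_sqr// mulr1.
  under eq_bigr do rewrite E.
  have avg0 m : 0 <= avg m (alive M s m) by apply: avg_ge0 => i _; exact: alive_ge0.
  rewrite -(subnKC Kn) big_split_ord /= -[leLHS]addr0 lerD//; last first.
    by apply: sumr_ge0 => m _; rewrite mulr_ge0.
  apply: (@le_trans _ _ (4^-1 * \sum_(m < K ^ 2) avg m (alive M s m))).
    by have := @sum_alive K (K ^ 2) s s1 K0 (leqnn _); rewrite -/M; lra.
  by rewrite mulr_sumr; apply: ler_sum => m _; rewrite ler_wpM2r// q4.
apply: le_trans (ler_norm_avg _ _) _.
rewrite -avgZ; apply: le_avg => i _.
by rewrite normrM mulrC ler_wpM2r// stopped_bound.
Qed.

(* Coefficients carried by the intervals [0, 2 ^- l). *)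
Definition chain c l j : R := (j == 0)%N%:R * c l.

Lemma hwalk_chain0 c n : hwalk (chain c) n 0 = \sum_(l < n) c l.
Proof.
by apply: eq_bigr => l _; rewrite /chain !div0n mul1r mulr1.
Qed.

(** The condition on [i] places the atom in the block [2^-(k+1), 2^-k), the right half of [0, 2^-k).
    There h_l is 1 for l < k, -1 for l = k and 0 for l > k. *)
Lemma hwalk_chain_block c n k i : (k < n)%N -> (i %/ 2 ^ (n - k.+1) = 1)%N ->
  hwalk (chain c) n i = \sum_(l < k) c l - c k.
Proof.
elim: n i => // n IH i; rewrite ltnS leq_eqVlt subSS => /orP[/eqP->|kn].
  rewrite subnn expn0 divn1 => ->.
  by rewrite hwalkS hwalk_chain0 /chain eqxx mul1r mulrN1.
have -> : (n - k = (n - k.+1).+1)%N by rewrite subnSK.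
move=> iE; have {}iE : (i./2 %/ 2 ^ (n - k.+1) = 1)%N.
  by rewrite -divn2 -divnMA -expnS.
rewrite hwalkS (IH _ kn iE) /chain; case: eqP => [h|_]; last by rewrite !mul0r addr0.
by move: iE; rewrite h div0n.
Qed.

(** The blocks are disjoint and block k has measure 2^-(k+1). The induction splits off block 0, the
    right half of [0, 1), and rescales the left half. *)
Lemma avg_ge_blocks n (F G : nat -> R) :
  (forall i, (i < 2 ^ n)%N -> 0 <= F i) ->
  (forall k i, (k < n)%N -> (i < 2 ^ n)%N -> (i %/ 2 ^ (n - k.+1) = 1)%N ->
     G k <= F i) ->
  \sum_(k < n) G k / 2 ^+ k.+1 <= avg n F.
Proof.
elim: n G => [|n IH] G F0 FG; first by rewrite big_ord0 avg_ge0.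
have e2 : (2 ^ n.+1 = 2 ^ n + 2 ^ n)%N by rewrite expnS mul2n addnn.
have -> : avg n.+1 F = avg n F / 2 + avg n (fun i => F (2 ^ n + i)%N) / 2.
  rewrite /avg e2 big_split_ord /= exprS; field; by rewrite gt_eqF.
have lt2 i : (i < 2 ^ n)%N -> (i < 2 ^ n.+1)%N.
  by move=> h; rewrite e2 ltn_addr.
have := IH (fun k => G k.+1) (fun i h => F0 i (lt2 i h)) (fun k i kn ik => FG k.+1 i kn (lt2 i ik)).
move=> h; rewrite [leLHS]big_ord_recl /= expr1 [leRHS]addrC; apply: lerD.
  rewrite ler_pM2r ?invr_gt0// -[leLHS](avg_cst n); apply: le_avg => i ik.
  apply: FG => //; first by rewrite e2 ltn_add2l.
  by rewrite subSS subn0 divnDl ?dvdnn// divnn expn_gt0 divn_small.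
apply: le_trans (_ : (\sum_(k < n) G k.+1 / 2 ^+ k.+1) / 2 <= _); last first.
  by rewrite ler_pM2r ?invr_gt0.
rewrite mulr_suml; apply: ler_sum => k _; rewrite [2 ^+ _.+2]exprSr invfM mulrA.
by [].
Qed.

(** The sum telescopes: 2^l h_l is the normalised indicator of [0, 2^-(l+1)) minus that of [0,
    2^-l). *)
Lemma hwalk_chain_pow n i : (i < 2 ^ n)%N ->
  hwalk (chain (fun l => 2 ^+ l)) n i = (i == 0)%N%:R * 2 ^+ n - 1.
Proof.
elim: n i => [|n IH] i; first by case: i => // _; rewrite hwalk0 mul1r subrr.
rewrite expnS mul2n => ilt.
have {}ilt : (i./2 < 2 ^ n)%N by rewrite ltn_half_double.
rewrite hwalkS IH // /chain exprS.
case: i {ilt} => [|[|i]] /=; rewrite ?mul0r ?mul1r; ring.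
Qed.

(* The Haar coefficients, at [0, 2 ^- l), of the indicator of
   [2 ^- m.+1, 2 ^- m) minus its mean. *)
Definition bump m l : R :=
  if (l < m)%N then (2 ^+ m.+1)^-1 * 2 ^+ l else if l == m then - 2^-1 else 0.

Lemma hwalk_bump m n i : (m < n)%N -> (i < 2 ^ n)%N ->
  hwalk (chain (bump m)) n i = (i %/ 2 ^ (n - m.+1) == 1)%N%:R - (2 ^+ m.+1)^-1.
Proof.
elim: n i => // n IH i; rewrite ltnS leq_eqVlt => /orP[/eqP->|mn].
  rewrite expnS mul2n => ilt.
  have {}ilt : (i./2 < 2 ^ n)%N by rewrite ltn_half_double.
  (* Here m = n, and below level m the coefficients of the bump are those of [hwalk_chain_pow] up to
     a factor. *)
  rewrite hwalkS (@eq_hwalk _ (fun l j => (2 ^+ n.+1)^-1 * chain (fun l => 2 ^+ l) l j)).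
    rewrite hwalkZ hwalk_chain_pow// /chain /bump ltnn eqxx subnn expn0 divn1.
    have := pow2_gt0 n; rewrite exprS => /gt_eqF /negbT p0.
    by case: i {ilt} => [|[|i]] /=; rewrite ?eqSS ?mul0r ?mul1r; field; rewrite ?p0.
  by move=> l j ln; rewrite /chain /bump ln mulrCA.
rewrite expnS mul2n => ilt.
have {}ilt : (i./2 < 2 ^ n)%N by rewrite ltn_half_double.
rewrite hwalkS (IH _ mn ilt) subSS -[(n - m)%N](subnSK mn) expnS divnMA divn2.
by rewrite /chain /bump ltnNge (ltnW mn) (gtn_eqF mn) /= mulr0 mul0r addr0.
Qed.

Lemma sum_blocks n i : \sum_(m < n) (i %/ 2 ^ (n - m.+1) == 1)%N%:R <= 1 :> R.
Proof.
(* The leading binary digit of a positive [i] selects one block, or [i] is at least 2^n. The extra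
   term for the latter makes the identity valid for all [i], so that the induction can pass to
   [i./2]. *)
suff : (\sum_(m < n) (i %/ 2 ^ (n - m.+1) == 1) + (0 < i %/ 2 ^ n) = (0 < i))%N.
  move=> h; rewrite -natr_sum -[leRHS](_ : 1%:R = 1)// ler_nat.
  by apply: leq_trans (leq_addr (0 < i %/ 2 ^ n) _) _; rewrite h; case: (0 < i)%N.
elim: n i => [|n IH] i; first by rewrite big_ord0 divn1.
rewrite big_ord_recr /= subnn expn0 divn1.
rewrite (eq_bigr (fun m : 'I_n => (i./2 %/ 2 ^ (n - m.+1) == 1)%N : nat)).
  by rewrite expnS divnMA divn2 addnAC IH; case: i => [|[|i]].
by move=> m _; rewrite subSS -[(n - m)%N](subnSK (ltn_ord m)) expnS divnMA divn2.
Qed.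

Lemma sum_inv_pow2 n : \sum_(m < n) (2 ^+ m.+1)^-1 <= 1 :> R.
Proof.
suff -> : \sum_(m < n) (2 ^+ m.+1)^-1 = 1 - (2 ^+ n)^-1 :> R.
  by rewrite gerBl invr_ge0 ltW.
elim: n => [|n IH]; first by rewrite big_ord0 expr0 invr1 subrr.
rewrite big_ord_recr /= IH exprS; field; by rewrite gt_eqF.
Qed.

(** The shift [d] is 0 if the projection keeps the levels l >= m, and 1 if it keeps l <= m: in the
    latter case [bump m] would leave only -2^-(m+1) at the point 0, whereas [bump m.+1] leaves at
    least 1/4. *)
Definition shifted_bump n d m l : R :=
  if (m + d < n)%N then bump (m + d) l else 0.

(** At a given point the indicators of the disjoint blocks add up to at most 1, and so do the means
    subtracted from them. *)
Lemma sum_shifted_bump n d i : (i < 2 ^ n)%N ->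
  \sum_(m < n) `|hwalk (chain (shifted_bump n d m)) n i| <= 2.
Proof.
move=> ilt.
pose G m : R := (i %/ 2 ^ (n - m.+1) == 1)%N%:R + (2 ^+ m.+1)^-1.
have G0 m : 0 <= G m by rewrite addr_ge0 ?ler0n ?invr_ge0// ltW.
apply: (@le_trans _ _ (\sum_(m < n) G m)); last first.
  by rewrite big_split /= -[2]/(1 + 1) lerD ?sum_blocks ?sum_inv_pow2.
apply: (@le_trans _ _ (\sum_(0 <= m < n | (m + d < n)%N) G (m + d)%N)).
  rewrite big_mkord [leRHS]big_mkcond /=; apply: ler_sum => m _.
  rewrite /shifted_bump; case: ifP => h; last first.
    rewrite (@eq_hwalk _ (fun l j => 0 * chain (bump m) l j)).
      by rewrite hwalkZ mul0r normr0.
    by move=> l j _; rewrite /chain mulr0 mul0r.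
  rewrite hwalk_bump// /G; apply: le_trans (ler_normB _ _) _.
  by rewrite !ger0_norm// invr_ge0 ltW.
have -> : \sum_(0 <= m < n | (m + d < n)%N) G (m + d)%N =
    \sum_(0 <= m < n - d) G (m + d)%N.
  rewrite [RHS](big_nat_widen _ _ n) ?leq_subr//.
  by apply: eq_bigl => m; rewrite ltn_subRL addnC.
rewrite -(big_mkord xpredT G).
case: (leqP d n) => dn; last first.
  move: (ltnW dn); rewrite -subn_eq0 => /eqP->; rewrite [leLHS]big_geq//.
  exact: sumr_ge0.
have := big_addn 0 n d xpredT G; rewrite add0n => <-.
rewrite [leRHS](big_cat_nat (n := d))//= lerDr.
exact: sumr_ge0.
Qed.

Lemma avg_chain_pow n :
  avg n (fun i => `|hwalk (chain (fun l => 2 ^+ l)) n i|) <= 2.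
Proof.
apply: (@le_trans _ _ (avg n (fun i => (i == 0)%N%:R * 2 ^+ n + 1))).
  apply: le_avg => i ilt; rewrite hwalk_chain_pow//.
  apply: le_trans (ler_normB _ _) _; rewrite normr1 ger0_norm//.
rewrite avgD avg_cst -[leRHS]/(1 + 1) lerD2r /avg.
have n0 : (0 < 2 ^ n)%N by rewrite expn_gt0.
rewrite (bigD1 (Ordinal n0))//= big1 => [|j].
  by rewrite addr0 mul1r mulVf// gt_eqF.
by rewrite -val_eqE /= => /negbTE->; rewrite mul0r.
Qed.

(** On block k the sum is 2^m + ... + 2^(k-1) - 2^k. For m = k its size 2^k compensates the measure
    of the block up to a factor 2; [chain_pow_low] serves likewise with m = k - 1. *)
Lemma chain_pow_up n k i m : (k < n)%N -> (i %/ 2 ^ (n - k.+1) = 1)%N ->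
  (m <= k)%N ->
  hwalk (chain (fun l => if (m <= l)%N then 2 ^+ l else 0)) n i = - 2 ^+ m.
Proof.
move=> kn ik mk; rewrite (hwalk_chain_block _ kn ik) mk.
elim: k mk {kn ik} => [|k IH].
  by rewrite leqn0 => /eqP->; rewrite big_ord0 sub0r.
rewrite leq_eqVlt => /orP[/eqP<-|mk].
  rewrite big1 ?sub0r// => l _; by rewrite leqNgt ltn_ord.
rewrite big_ord_recr /= -ltnS mk -(IH mk) exprS; ring.
Qed.

Lemma sum_pow2_low k : \sum_(l < k) 2 ^+ l = 2 ^+ k - 1 :> R.
Proof.
elim: k => [|k IH]; first by rewrite big_ord0 subrr.
by rewrite big_ord_recr /= IH exprS; ring.
Qed.

Lemma chain_pow_low n k i m : (k < n)%N -> (i %/ 2 ^ (n - k.+1) = 1)%N ->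
  (m < k)%N ->
  hwalk (chain (fun l => if (l <= m)%N then 2 ^+ l else 0)) n i = 2 ^+ m.+1 - 1.
Proof.
move=> kn ik mk; rewrite (hwalk_chain_block _ kn ik) leqNgt mk subr0.
rewrite -(subnKC mk) big_split_ord /= [X in _ + X]big1 ?addr0.
  rewrite -sum_pow2_low; apply: eq_bigr => l _.
  by rewrite -ltnS ltn_ord.
by move=> l _; rewrite leqNgt addSn ltnS leq_addr.
Qed.

End HaarWalk.

(** * Dyadic step functions and their distributions *)

Section StepFunctions.
Context {R : realType}.
Implicit Types (s t : R) (u v : nat -> R) (X : haar_system_space R).

(** The index of the interval of length 2^-N containing [s]. Truncation sends negative reals to 0,
    whence the condition 0 <= s below. *)
Definition atom N s : nat := Num.truncn (2 ^+ N * s).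

Lemma atom_bounds N s : 0 <= s -> (atom N s)%:R <= 2 ^+ N * s < (atom N s).+1%:R.
Proof. by move=> s0; rewrite truncn_itv// mulr_ge0// exprn_ge0. Qed.

Lemma atomP N i s : Defs.dyadic_itv N i s <-> 0 <= s /\ atom N s = i.
Proof.
have p0 : 0 < 2 ^+ N :> R by rewrite exprn_gt0.
rewrite /Defs.dyadic_itv /= in_itv /= ler_pdivrMr// ltr_pdivlMr// !(mulrC s).
split=> [sN|[s0 <-]]; last exact: atom_bounds.
split; last exact: truncn_def.
have /andP[+ _] := sN; rewrite -(pmulr_rge0 _ p0); exact: le_trans (ler0n _ _).
Qed.

Lemma atom_lt N s : 0 <= s < 1 -> (atom N s < 2 ^ N)%N.
Proof.
move=> /andP[s0 s1]; rewrite truncn_lt_nat ?mulr_ge0 ?exprn_ge0// natrX.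
by rewrite -[ltRHS]mulr1 ltr_pM2l ?exprn_gt0.
Qed.

Lemma atom_div N j s : 0 <= s -> (j <= N)%N ->
  atom j s = (atom N s %/ 2 ^ (N - j))%N.
Proof.
move=> s0 jN; apply: truncn_def.
have d0 : 0 < 2 ^+ (N - j) :> R by rewrite exprn_gt0.
rewrite -(ler_pM2r d0) -[X in _ && X](ltr_pM2r d0).
have dE : 2 ^+ (N - j) = (2 ^ (N - j))%:R :> R by rewrite natrX.
rewrite mulrAC -exprD subnKC// dE -!natrM.
have /andP[h1 h2] := atom_bounds N s0.
apply/andP; split.
  by apply: le_trans h1; rewrite ler_nat leq_trunc_div.
apply: lt_le_trans h2 _; rewrite ler_nat -ltn_divLR ?expn_gt0//.
Qed.

Definition stepf N v : R -> R :=
  fun s => if 0 <= s < 1 then v (atom N s) else 0.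

Lemma eq_stepf N u v : (forall i, (i < 2 ^ N)%N -> u i = v i) ->
  stepf N u = stepf N v.
Proof.
move=> uv; apply/funext => s; rewrite /stepf; case: ifPn => // s01.
by rewrite uv// atom_lt.
Qed.

Lemma stepf_sum N v : stepf N v =
  fun s => \sum_(i < 2 ^ N) v i * \1_(Defs.dyadic_itv N i) s.
Proof.
apply/funext => s; rewrite /stepf; case: ifPn => s01.
  rewrite (bigD1 (Ordinal (atom_lt N s01)))//= big1 => [|i].
    rewrite addr0 indicE mem_set ?mulr1//; apply/atomP.
    by case/andP: s01.
  rewrite -val_eqE /= => ni; rewrite indicE memNset ?mulr0// => /atomP[_ h].
  by rewrite h eqxx in ni.
rewrite big1// => i _; rewrite indicE memNset ?mulr0// => /atomP[s0 h].
move: s01; rewrite s0 /= -leNgt => s1.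
suff : (2 ^ N <= i)%N by rewrite leqNgt ltn_ord.
rewrite -h truncn_ge_nat ?mulr_ge0 ?exprn_ge0// natrX.
by rewrite ler_peMr// exprn_ge0.
Qed.

Lemma V1_stepf N v : V1 (stepf N v).
Proof.
exists [seq (v i, existT (fun j => 'I_(2 ^ j)) N i) | i : 'I_(2 ^ N)].
rewrite stepf_sum; apply/funext => s.
by rewrite big_map big_enum.
Qed.

Lemma leb01_itv N i : (i < 2 ^ N)%N ->
  leb01 (Defs.dyadic_itv N i : set R) = ((2 ^+ N)^-1)%:E.
Proof.
move=> iN; rewrite /leb01 /= /mrestr.
have p0 : 0 < 2 ^+ N :> R by rewrite exprn_gt0.
rewrite setIidl; last first.
  move=> s; rewrite /Defs.dyadic_itv /= !in_itv /= => /andP[h1 h2]; apply/andP; split.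
    by apply: le_trans h1; rewrite divr_ge0 ?ler0n ?ltW.
  apply: lt_le_trans h2 _; rewrite ler_pdivrMr// mul1r -natrX ler_nat//.
rewrite /Defs.dyadic_itv lebesgue_measure_itv /= lte_fin ltr_pM2r ?invr_gt0//.
by rewrite ltr_nat ltnSn -EFinD -mulrBl -natrB// subSnn mul1r.
Qed.

Lemma leb01_atom N (Q : pred nat) :
  leb01 [set s : R | 0 <= s < 1 /\ Q (atom N s)] =
  (avg N (fun i => (Q i)%:R))%:E.
Proof.
pose F i : set (measurableTypeR R) := if Q i then Defs.dyadic_itv N i else set0.
have mF i : measurable (F i).
  by rewrite /F; case: ifP => _ //; exact: measurable_itv.
have tF : trivIset setT F.
  move=> i j _ _ [s []]; rewrite /F; case: ifP => // _ /atomP[_ <-].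
  by case: ifP => // _ /atomP[_ <-].
have -> : [set s : R | 0 <= s < 1 /\ Q (atom N s)] =
    \big[setU/set0]_(i < 2 ^ N) F i.
  apply/seteqP; split=> [s [s01 Qs]|s].
    rewrite -bigcup_mkord; exists (atom N s); first exact: atom_lt.
    by rewrite /F Qs; apply/atomP; case/andP: s01.
  rewrite -bigcup_mkord => -[i /= iN]; rewrite /F; case: ifP => // Qi si.
  have : [set` `[0%R, 1%R[] s.
    have := si; rewrite /Defs.dyadic_itv /= !in_itv /= => /andP[h1 h2].
    have p0 : 0 < 2 ^+ N :> R by rewrite exprn_gt0.
    apply/andP; split; first by apply: le_trans h1; rewrite divr_ge0 ?ler0n ?ltW.
    by apply: lt_le_trans h2 _; rewrite ler_pdivrMr// mul1r -natrX ler_nat.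
  rewrite /= in_itv /= => s01; split=> //.
  by move/atomP : si => [_ ->].
rewrite measure_bigsetU//= /avg mulr_sumr -sumEFin; apply: eq_bigr => i _.
rewrite /F; case: ifP => _; first by rewrite mulr1; exact: leb01_itv.
by rewrite mulr0; exact: measure0.
Qed.

Lemma leb01_setI (A : set R) :
  leb01 A = leb01 (A `&` [set s | 0 <= s < 1]).
Proof.
rewrite /leb01 /= /mrestr; congr (lebesgue_measure _).
apply/seteqP; split => s /=; rewrite in_itv /=; tauto.
Qed.

Lemma leb01_stepf N v (B : set R) :
  leb01 ((fun s => `|stepf N v s|) @^-1` B) =
  (avg N (fun i => (`|v i| \in B)%:R))%:E.
Proof.
rewrite leb01_setI -leb01_atom; congr (leb01 _); apply/seteqP; split => s /=.
  by case=> + s01; rewrite /stepf s01 => h; split=> //; apply/mem_set.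
by case=> s01 /set_mem h; rewrite /stepf s01.
Qed.

Lemma stepf_same_distribution N u v :
  (forall B : set R, avg N (fun i => (`|u i| \in B)%:R) =
                     avg N (fun i => (`|v i| \in B)%:R) :> R) ->
  same_abs_distribution (stepf N u) (stepf N v).
Proof. by move=> h B _; rewrite !leb01_stepf h. Qed.

(** * Monotonicity and extremal bounds for rearrangement invariant norms *)

Definition snorm X N v : R := X (stepf N v).

Lemma eq_snorm X N u v : (forall i, (i < 2 ^ N)%N -> u i = v i) ->
  snorm X N u = snorm X N v.
Proof. by move=> uv; rewrite /snorm (eq_stepf uv). Qed.

Lemma eq_abs_snorm X N u v : (forall i, (i < 2 ^ N)%N -> `|u i| = `|v i|) ->
  snorm X N u = snorm X N v.
Proof.
move=> uv; apply: hss_invariant; try exact: V1_stepf.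
by apply: stepf_same_distribution => B; apply: eq_avg => i iN; rewrite uv.
Qed.

Lemma snormZ X N c v : snorm X N (fun i => c * v i) = `|c| * snorm X N v.
Proof.
rewrite /snorm -hss_scale; last exact: V1_stepf.
by congr (X _); apply/funext => s; rewrite /stepf; case: ifP; rewrite ?mulr0.
Qed.

Lemma ler_snormD X N u v :
  snorm X N (fun i => u i + v i) <= snorm X N u + snorm X N v.
Proof.
apply: le_trans (@hss_triangle _ X _ _ (V1_stepf N u) (V1_stepf N v)).
rewrite /snorm le_eqVlt; apply/orP; left; apply/eqP.
by congr (X _); apply/funext => s; rewrite /stepf; case: ifP; rewrite ?addr0.
Qed.

Lemma snorm_cst X N c : snorm X N (fun=> c) = `|c|.
Proof.
rewrite -[c]mulr1 snormZ normrM normr1; congr (_ * _).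
rewrite -[RHS](hss_normalized X) /snorm; congr (X _); apply/funext => s.
rewrite /stepf indicE; case: ifPn => h; first by rewrite mem_set//= in_itv.
by rewrite memNset//= in_itv /=; exact/negP.
Qed.

Lemma ler_snorm_sum X N I (r : seq I) (F : I -> nat -> R) :
  snorm X N (fun i => \sum_(k <- r) F k i) <= \sum_(k <- r) snorm X N (F k).
Proof.
elim: r => [|k r IH].
  rewrite big_nil (@eq_snorm X N _ (fun=> 0)) ?snorm_cst ?normr0// => i _.
  by rewrite big_nil.
rewrite big_cons (@eq_snorm X N _ (fun i => F k i + \sum_(k <- r) F k i)).
  by apply: le_trans (ler_snormD _ _ _ _) _; rewrite lerD2l.
by move=> i _; rewrite big_cons.
Qed.

(* Replacing one value by a smaller one yields a convex combination of the
   original function and of its reflection in that coordinate. *)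
Lemma le_snorm_coord X N v k (a : R) : `|a| <= `|v k| ->
  snorm X N (fun i => if i == k then a else v i) <= snorm X N v.
Proof.
move=> av; have [v0|v0] := eqVneq (v k) 0.
  rewrite (@eq_snorm X N _ v)// => i _; case: eqP => // ->.
  by move: av; rewrite v0 normr0 normr_le0 => /eqP.
pose c := a / v k; pose v' i := if i == k then - v i else v i.
have c1 : `|c| <= 1 by rewrite normrM normfV ler_pdivrMr ?normr_gt0// mul1r.
have /andP[c1l c1r] : -1 <= c <= 1 by rewrite -ler_norml.
have -> : snorm X N (fun i => if i == k then a else v i) =
    snorm X N (fun i => (1 + c) / 2 * v i + (1 - c) / 2 * v' i).
  apply: eq_snorm => i _; rewrite /v'; case: eqP => [->|_]; last by field.
  by rewrite /c; field.
apply: le_trans (ler_snormD _ _ _ _) _; rewrite !snormZ.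
have -> : snorm X N v' = snorm X N v.
  by apply: eq_abs_snorm => i _; rewrite /v'; case: ifP => _; rewrite ?normrN.
rewrite !ger0_norm; [|lra|lra]; rewrite -mulrDl.
have -> : (1 + c) / 2 + (1 - c) / 2 = 1 by field.
by rewrite mul1r.
Qed.

(** The values of [v] are replaced one at a time by [le_snorm_coord]; [w k] has the first k of them
    replaced. *)
Lemma le_snorm X N u v : (forall i, (i < 2 ^ N)%N -> `|u i| <= `|v i|) ->
  snorm X N u <= snorm X N v.
Proof.
move=> uv; pose w k i := if (i < k)%N then u i else v i.
have wk k : (k <= 2 ^ N)%N -> snorm X N (w k) <= snorm X N v.
  elim: k => [_|k IH kN].
    by rewrite (@eq_snorm X N _ v).
  apply: le_trans (IH (ltnW kN)).
  rewrite (@eq_snorm X N _ (fun i => if i == k then u k else w k i)).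
    by apply: le_snorm_coord; rewrite /w ltnn uv.
  move=> i _; rewrite /w ltnS leq_eqVlt; case: eqP => [->|]//=.
by rewrite (@eq_snorm X N _ (w (2 ^ N)%N)) ?wk// => i iN; rewrite /w iN.
Qed.

Lemma snorm_le_cst X N u c : (forall i, (i < 2 ^ N)%N -> `|u i| <= c) ->
  snorm X N u <= c.
Proof.
move=> uc; have c0 : 0 <= c by apply: le_trans (uc 0%N _); rewrite ?expn_gt0.
rewrite -[leRHS](ger0_norm c0) -[leRHS](snorm_cst X N).
by apply: le_snorm => i iN; rewrite (ger0_norm c0) uc.
Qed.

Lemma shift_ord_inj (n k : nat) : (0 < n)%N ->
  {in [pred i | (i < n)%N] &, injective (fun i => (i + k) %% n)%N}.
Proof.
move=> n0 i j; rewrite !inE => ilt jlt /eqP.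
by rewrite eqn_modDr !modn_small// => /eqP.
Qed.

Lemma sum_shift (n k : nat) (F : nat -> R) : (0 < n)%N ->
  \sum_(i < n) F ((i + k) %% n)%N = \sum_(i < n) F i.
Proof.
move=> n0; have h (i : 'I_n) : ((i + k) %% n < n)%N by rewrite ltn_mod.
rewrite [RHS](reindex_inj (h := fun i : 'I_n => Ordinal (h i)))//.
move=> i j /(congr1 val) /= /(shift_ord_inj n0) e.
by apply: val_inj; apply: e; rewrite inE.
Qed.

(* The mean of the cyclic shifts of [|v|], all of them equimeasurable with [v],
   is constant. *)
Lemma avg_le_snorm X N v : avg N (fun i => `|v i|) <= snorm X N v.
Proof.
pose n := (2 ^ N)%N; have n0 : (0 < n)%N by rewrite expn_gt0.
pose S k i := `|v ((i + k) %% n)%N|.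
have nR : (2 ^+ N : R) = n%:R by rewrite natrX.
have nR0 : 0 < n%:R :> R by rewrite ltr0n.
have Sv k : snorm X N (S k) = snorm X N v.
  apply: hss_invariant; try exact: V1_stepf.
  apply: stepf_same_distribution => B; congr (_ * _).
  rewrite -(sum_shift k (fun i => (`|v i| \in B)%:R) n0).
  by apply: eq_bigr => i _; rewrite /S normr_id.
have a0 : 0 <= avg N (fun i => `|v i|) by exact: avg_ge0.
rewrite -[leLHS](ger0_norm a0) -[leLHS](snorm_cst X N).
have -> : snorm X N (fun=> avg N (fun i => `|v i|)) =
    n%:R^-1 * snorm X N (fun i => \sum_(k <- iota 0 n) S k i).
  rewrite -[X in X * _]ger0_norm ?invr_ge0 ?ler0n// -snormZ.
  apply: eq_snorm => i iN; rewrite /avg nR; congr (_ * _).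
  rewrite -[X in \sum_(k <- iota 0 X) _]subn0 -/(index_iota 0 n) big_mkord.
  rewrite -(sum_shift i (fun i => `|v i|) n0).
  by apply: eq_bigr => k _; rewrite /S addnC.
rewrite ler_pdivrMl//; apply: le_trans (ler_snorm_sum _ _ _ _) _.
under eq_bigr do rewrite Sv.
by rewrite big_const_seq count_predT size_iota iter_addr_0 mulr_natl.
Qed.

Lemma snorm_ge0 X N v : 0 <= snorm X N v.
Proof. by apply: le_trans (avg_le_snorm _ _ _); apply: avg_ge0. Qed.

(** * Comparison with the norms of L^1 and L^oo *)

Lemma stepf_ge0_sum N v :
  (fun s => `|stepf N v s|) = fun s => \sum_(i < 2 ^ N) `|v i| * \1_(Defs.dyadic_itv N i) s.
Proof.
rewrite -(stepf_sum N (fun i => `|v i|)); apply/funext => s; rewrite /stepf.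
by case: ifP; rewrite ?normr0.
Qed.

Lemma measurable_dyadic_itv N i :
  measurable (Defs.dyadic_itv N i : set (measurableTypeR R)).
Proof. exact: measurable_itv. Qed.

Lemma Lnorm1_stepf N v :
  ('N[leb01]_1[EFin \o stepf N v] = (avg N (fun i => `|v i|))%:E)%E.
Proof.
rewrite Lnorm1.
transitivity (\int[leb01]_s (\sum_(i < 2 ^ N)
    (`|v i|%:E * (\1_(Defs.dyadic_itv N i : set (measurableTypeR R)) s)%:E)))%E.
  apply: eq_integral => s _ /=.
  by rewrite (congr1 (fun f => f s) (stepf_ge0_sum N v)) -sumEFin.
rewrite ge0_integral_sum//=; first last.
- move=> i; apply/measurable_EFinP; apply: measurable_funM => //.
  apply: measurable_indic; exact: measurable_dyadic_itv.
rewrite /avg mulr_sumr -sumEFin; apply: eq_bigr => i _.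
rewrite ge0_integralZl//; first last.
- apply/measurable_EFinP; apply: measurable_indic; exact: measurable_dyadic_itv.
rewrite integral_indic//; last exact: measurable_dyadic_itv.
by rewrite setIT leb01_itv// -EFinM mulrC.
Qed.

(** If the essential supremum were smaller, the atom [0, 2^-N), of positive measure, would lie in a
    null set. *)
Lemma le_Lnormy_stepf N v :
  (`|v 0%N|%:E <= 'N[leb01]_+oo[EFin \o stepf N v])%E.
Proof.
have m0 : leb01 (Defs.dyadic_itv N 0 : set (measurableTypeR R)) = ((2 ^+ N)^-1)%:E.
  by apply: leb01_itv; rewrite expn_gt0.
have p0 : (0 < leb01 (Defs.dyadic_itv N 0 : set (measurableTypeR R)))%E.
  by rewrite m0 lte_fin invr_gt0 exprn_gt0.
(* The norm is an essential supremum only when the whole space has positive measure, which the atom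
   ensures. *)
rewrite unlock /=; case: ifPn => [_|]; last first.
  move=> /negP[]; apply: lt_le_trans p0 _; apply: le_measure; rewrite ?inE//.
  exact: measurable_dyadic_itv.
rewrite leNgt; apply/negP => lt.
have := ess_sup_ge leb01 (abse \o (EFin \o stepf N v)) => -[A [mA A0 hA]].
suff : (leb01 (Defs.dyadic_itv N 0 : set (measurableTypeR R)) <= leb01 A)%E.
  by rewrite A0 leNgt p0.
apply: le_measure; rewrite ?inE//; first exact: measurable_dyadic_itv.
move=> s /atomP[s0 a0]; apply: hA => /=; apply/negP; rewrite -ltNge.
have s1 : 0 <= s < 1.
  rewrite s0 /=; have /andP[_] := atom_bounds N s0; rewrite a0.
  apply: le_lt_trans; rewrite ler_peMl//.
  by rewrite exprn_ege1// ler1n.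
by rewrite /stepf s1 a0.
Qed.

Lemma equiv_L1_snorm X : equiv_Lp X 1%E -> exists2 C, 0 < C &
  forall N v, snorm X N v <= C * avg N (fun i => `|v i|).
Proof.
move=> [c [C [c0 C0 h]]]; exists C => // N v.
have /andP[_] := h _ (V1_stepf N v).
by rewrite Lnorm1_stepf -EFinM lee_fin.
Qed.

Lemma equiv_Linf_snorm X : equiv_Lp X +oo%E -> exists2 c, 0 < c &
  forall N v, c * `|v 0%N| <= snorm X N v.
Proof.
move=> [c [C [c0 C0 h]]]; exists c => // N v.
have /andP[+ _] := h _ (V1_stepf N v) => h'.
rewrite -lee_fin EFinM; apply: le_trans h'.
apply: lee_wpmul2l; first by rewrite lee_fin ltW.
exact: le_Lnormy_stepf.
Qed.

End StepFunctions.

(** * Expectations of bounded measurable functions *)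

Section BoundedMeasurable.
Context {d : measure_display} {T : measurableType d} {R : realType}
  (P : probability T R).
Implicit Types f g : T -> R.

(** A class stable under the operations below and integrable under a probability, so that linearity
    and monotonicity of [expect] apply to all the functions met later. *)
Definition bounded_mfun f :=
  measurable_fun setT f /\ exists A : R, forall w, `|f w| <= A.

Lemma bounded_mfun_cst (c : R) : bounded_mfun (fun=> c).
Proof. by split; [exact: measurable_cst | exists `|c|]. Qed.

Lemma bounded_mfunD f g : bounded_mfun f -> bounded_mfun g ->
  bounded_mfun (fun w => f w + g w).
Proof.
move=> [mf [A fA]] [mg [B gB]]; split; first exact: measurable_funD.
by exists (A + B) => w; apply: le_trans (ler_normD _ _) _; rewrite lerD.
Qed.

Lemma bounded_mfunM f g : bounded_mfun f -> bounded_mfun g ->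
  bounded_mfun (fun w => f w * g w).
Proof.
move=> [mf [A fA]] [mg [B gB]]; split; first exact: measurable_funM.
by exists (A * B) => w; rewrite normrM ler_pM.
Qed.

Lemma bounded_mfun_norm f : bounded_mfun f -> bounded_mfun (fun w => `|f w|).
Proof.
move=> [mf [A fA]]; split; first exact: measurableT_comp.
by exists A => w; rewrite normr_id.
Qed.

Lemma bounded_mfun_sum n (F : nat -> T -> R) : (forall i, bounded_mfun (F i)) ->
  bounded_mfun (fun w => \sum_(i < n) F i w).
Proof.
move=> bF; elim: n => [|n IH].
  by under eq_fun do rewrite big_ord0; exact: bounded_mfun_cst.
by under eq_fun do rewrite big_ord_recr /=; exact: bounded_mfunD.
Qed.

Lemma bounded_mfun_hwalk (u : T -> nat -> nat -> R) n i :
  (forall m j, bounded_mfun (fun w => u w m j)) ->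
  bounded_mfun (fun w => hwalk (u w) n i).
Proof.
move=> bu; apply: (@bounded_mfun_sum n (fun m w => u w m (i %/ 2 ^ (n - m))%N *
  (-1) ^+ odd (i %/ 2 ^ (n - m.+1)))) => m.
apply: bounded_mfunM; [exact: bu | exact: bounded_mfun_cst].
Qed.

Lemma bounded_mfun_integrable f : bounded_mfun f -> P.-integrable setT (EFin \o f).
Proof.
move=> [mf [A fA]]; apply: measurable_bounded_integrable => //.
  by apply: (@le_lt_trans _ _ 1%E); [exact: probability_le1 | exact: ltry].
by exists A; split; [exact: num_real | move=> x Ax w _ /=; apply: le_trans (ltW Ax)].
Qed.

Definition expect f : R := fine 'E_P[f].

Lemma expectE f : expect f = Rintegral P setT f.
Proof. by rewrite /expect unlock. Qed.

Lemma expect_cst (c : R) : expect (fun=> c) = c.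
Proof.
rewrite expectE; transitivity (c * fine (P setT)); first exact: Rintegral_cst.
by rewrite probability_setT mulr1.
Qed.

Lemma expectZ c f : bounded_mfun f -> expect (fun w => c * f w) = c * expect f.
Proof. by move=> /bounded_mfun_integrable fi; rewrite !expectE RintegralZl. Qed.

Lemma expectD f g : bounded_mfun f -> bounded_mfun g ->
  expect (fun w => f w + g w) = expect f + expect g.
Proof.
by move=> /bounded_mfun_integrable fi /bounded_mfun_integrable gi; rewrite !expectE RintegralD.
Qed.

Lemma expect_sum n (F : nat -> T -> R) : (forall i, bounded_mfun (F i)) ->
  expect (fun w => \sum_(i < n) F i w) = \sum_(i < n) expect (F i).
Proof.
move=> bF; elim: n => [|n IH].
  by rewrite big_ord0 -[RHS]expect_cst; congr expect; apply/funext => w; rewrite big_ord0.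
rewrite big_ord_recr /= -IH -expectD//; last exact: bounded_mfun_sum.
by congr expect; apply/funext => w; rewrite big_ord_recr.
Qed.

Lemma le_expect f g : bounded_mfun f -> bounded_mfun g ->
  (forall w, f w <= g w) -> expect f <= expect g.
Proof.
move=> /bounded_mfun_integrable fi /bounded_mfun_integrable gi fg.
by rewrite !expectE; apply: le_Rintegral.
Qed.

Lemma expect_ge0 f : (forall w, 0 <= f w) -> 0 <= expect f.
Proof. by move=> f0; rewrite expectE; apply: Rintegral_ge0. Qed.

Lemma expect_le_cst f c : bounded_mfun f -> (forall w, f w <= c) -> expect f <= c.
Proof.
move=> bf fc; rewrite -[leRHS]expect_cst; apply: le_expect => //.
exact: bounded_mfun_cst.
Qed.

Lemma expect_ge_cst f c : bounded_mfun f -> (forall w, c <= f w) -> c <= expect f.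
Proof.
move=> bf fc; rewrite -[leLHS]expect_cst; apply: le_expect => //.
exact: bounded_mfun_cst.
Qed.

Lemma eq_expect_ae f g : bounded_mfun f -> bounded_mfun g ->
  (\forall w \ae P, f w = g w) -> expect f = expect g.
Proof.
move=> [mf _] [mg _] fg; rewrite !expectE; congr fine.
apply: ae_eq_integral => //; [exact/measurable_EFinP|exact/measurable_EFinP|].
by apply: filterS fg => w -> _.
Qed.

Lemma avg_expect n (F : nat -> T -> R) : (forall i, bounded_mfun (F i)) ->
  avg n (fun i => expect (F i)) = expect (fun w => avg n (fun i => F i w)).
Proof. by move=> bF; rewrite /avg -expect_sum// -expectZ//; exact: bounded_mfun_sum. Qed.

(* All that the proof uses of the law of the signs. *)
Record sign_system (c : bool) (e : dyadic -> T -> R) : Prop := SignSystem {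
  sign_system_mfun : forall I, bounded_mfun (e I) ;
  sign_system_norm : forall I w, `|e I w| = 1 ;
  sign_system_cst : c -> forall I, \forall w \ae P, e I w = 1 ;
  sign_system_uncorrelated : ~~ c -> forall I J, I != J ->
    expect (fun w => e I w * e J w) = 0 }.


(** * Correlations of the signs under the Haar measure *)

Lemma sign_ofE (w : signs) I : sign_of R w I = 1 - 2 * (w I)%:R.
Proof. by rewrite /sign_of; case: (w I) => /=; rewrite ?expr0 ?expr1; ring. Qed.

Lemma measurable_sign_coord I b : measurable ([set w | w I = b] : set signs).
Proof. by apply: sub_sigma_algebra; exists I, b. Qed.

(** Cylinders on one or two coordinates suffice. For constant signs the value [true], which encodes
    -1, has mass 0; for random signs each joint value of two distinct coordinates has mass 1/4. *)
Lemma sign_system_law (c : bool) (pr : T -> signs) : measurable_fun setT pr ->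
  (forall (F : seq dyadic) (e : dyadic -> bool), uniq F ->
    P [set w | {in F, forall I, pr w I = e I}] =
    (\prod_(I <- F) coord_law R c (e I))%:E) ->
  sign_system c (fun I w => sign_of R (pr w) I).
Proof.
move=> mpr prP.
have mI I b : measurable [set w | pr w I = b].
  by have := mpr measurableT _ (measurable_sign_coord I b); rewrite setTI.
have bI (A : set T) : measurable A -> bounded_mfun (\1_A : T -> R).
  move=> mA; split; first exact: measurable_indic.
  by exists 1 => w; rewrite indicE; case: (_ \in _); rewrite ?normr1 ?normr0.
split.
- move=> I.
  have -> : (fun w => sign_of R (pr w) I) =
      (fun w => 1 + - 2 * \1_[set w | pr w I = true] w).
    apply/funext => w; rewrite sign_ofE indicE mulNr; congr (1 - 2 * _).
    by case: (boolP (pr w I)) => h; [rewrite mem_set | rewrite memNset//=; exact/negP].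
  apply: bounded_mfunD; first exact: bounded_mfun_cst.
  by apply: bounded_mfunM; [exact: bounded_mfun_cst | exact: bI].
- by move=> I w; rewrite normr_sign.
- move=> c1 I; exists [set w | pr w I = true]; split => //=.
    rewrite (_ : [set w | pr w I = true] =
        [set w | {in [:: I], forall J, pr w J = (fun=> true) J}]).
      by rewrite prP// big_seq1 c1.
    apply/seteqP; split => w /= h; last by apply: h; rewrite inE.
    by move=> J; rewrite inE => /eqP->.
  by move=> w /=; apply: contra_notP => /negP/negbTE h; rewrite sign_ofE h mulr0 subr0.
- move=> /negbTE c0 I J IJ.
  pose ev b b' K := if K == I then b else b' : bool.
  pose A b b' := [set w | pr w I = b] `&` [set w | pr w J = b'].
  have mA b b' : measurable (A b b') by apply: measurableI.
  have PA b b' : expect (\1_(A b b')) = 4^-1.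
    rewrite /expect expectation_indic//.
    rewrite (_ : A b b' = [set w | {in [:: I; J], forall K, pr w K = ev b b' K}]).
      rewrite prP /= ?inE ?IJ// big_cons big_seq1 /ev eqxx eq_sym (negbTE IJ) c0 /=.
      by field.
    apply/seteqP; split => w /=.
      move=> [h1 h2] K; rewrite !inE /ev => /orP[/eqP->|/eqP->]; first by rewrite eqxx.
      by rewrite eq_sym (negbTE IJ).
    move=> h; split; [have := h I | have := h J]; rewrite !inE eqxx ?orbT /ev ?eqxx; first exact.
    by rewrite eq_sym (negbTE IJ); exact.
  (* The product is the indicator that the two signs agree minus the indicator that they differ. *)
  have -> : (fun w => sign_of R (pr w) I * sign_of R (pr w) J) =
      (fun w => (\1_(A false false) w + \1_(A true true) w) +
                -1 * (\1_(A true false) w + \1_(A false true) w)).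
    apply/funext => w; rewrite !sign_ofE !indicE.
    have E b b' : (w \in A b b') = (pr w I == b) && (pr w J == b').
      by apply/idP/andP => [/set_mem[/= -> ->]|[/eqP h1 /eqP h2]]; rewrite ?eqxx//; apply: mem_set.
    by rewrite !E; case: (pr w I); case: (pr w J) => /=; ring.
  rewrite expectD; last 2 first.
  - by apply: bounded_mfunD; apply: bI.
  - by apply: bounded_mfunM; [exact: bounded_mfun_cst | apply: bounded_mfunD; apply: bI].
  rewrite expectZ; last by apply: bounded_mfunD; apply: bI.
  by rewrite !expectD ?PA; try exact: bI; ring.
Qed.

End BoundedMeasurable.

Lemma haar_measure_signs (R : realType) (c1 c2 : bool)
    (P : probability (signs * signs)%type R) : is_haar_measure c1 c2 P ->
  sign_system P c1 (fun I w => sign_of R w.1 I) /\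
  sign_system P c2 (fun I w => sign_of R w.2 I).
Proof.
move=> hP; split; apply: sign_system_law.
- exact: measurable_fst.
- move=> F e uF; have := hP F [::] e e uF isT; rewrite big_nil mulr1 => <-.
  by congr (P _); apply/seteqP; split => w /= => [h|[]//]; split.
- exact: measurable_snd.
- move=> F e uF; have := hP [::] F e e isT uF; rewrite big_nil mul1r => <-.
  by congr (P _); apply/seteqP; split => w /= => [h|[]//]; split.
Qed.

(** * Pointwise evaluation of Haar sums in two variables *)

Section HaarSums.
Context {R : realType}.
Implicit Types (s t : R) (b : nat -> nat -> nat -> R).

Lemma pow2n_gt0 m : (0 < 2 ^ m)%N.
Proof. by rewrite expn_gt0. Qed.

(* For [i >= 2 ^ m] this is the leftmost interval. *)
Definition interval_at (m i : nat) : dyadic :=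
  existT (fun j => 'I_(2 ^ j)) m (insubd (Ordinal (pow2n_gt0 m)) i).

Lemma interval_atK m i : (i < 2 ^ m)%N -> tagged (interval_at m i) = i :> nat.
Proof. by move=> h; rewrite /= val_insubd h. Qed.

Lemma interval_at_eta (I : dyadic) : I = interval_at (tag I) (tagged I).
Proof.
case: I => m i; congr existT; apply: val_inj => /=.
by rewrite val_insubd ltn_ord.
Qed.

(** The half of [I] containing [s] is told by the parity of the index of [s] one level further
    down. *)
Lemma haarE (I : dyadic) s : haar I s =
  if (0 <= s < 1) && (I == interval_at (tag I) (atom (tag I) s))
  then (-1) ^+ odd (atom (tag I).+1 s) else 0.
Proof.
case: I => m i; rewrite /haar /dleft /dright /=.
have [s0|s0] := boolP (0 <= s); last first.
  by rewrite !indicE !memNset ?subrr// => /atomP[h]; rewrite h in s0.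
have aE : atom m s = (atom m.+1 s)./2.
  by rewrite (atom_div s0 (leqnSn m)) subSnn expn1 divn2.
have [s1|s1] := boolP (s < 1) => /=; last first.
  (* For s >= 1 the index of [s] exceeds that of both halves of any interval of level [m]. *)
  have big : (2 ^ m.+1 <= atom m.+1 s)%N.
    rewrite truncn_ge_nat ?mulr_ge0 ?exprn_ge0// natrX ler_peMr ?exprn_ge0//.
    by rewrite leNgt.
  have [h1 h2] : (i.*2 < 2 ^ m.+1)%N /\ (i.*2.+1 < 2 ^ m.+1)%N.
    rewrite expnS mul2n ltn_double ltn_Sdouble; split; exact: ltn_ord.
  by rewrite !indicE !memNset ?subrr// => /atomP[_ h];
    move: big; rewrite h leqNgt ?h1 ?h2.
have s01 : 0 <= s < 1 by rewrite s0.
have -> : (existT (fun j => 'I_(2 ^ j)) m i == interval_at m (atom m s)) =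
    (i == atom m s :> nat).
  apply/eqP/eqP => [h|h]; last by rewrite [LHS]interval_at_eta /= h.
  have : tagged (existT (fun j => 'I_(2 ^ j)) m i) = atom m s :> nat.
    by rewrite h interval_atK// atom_lt.
  by [].
rewrite aE !indicE.
have E j : (s \in Defs.dyadic_itv m.+1 j) = (atom m.+1 s == j).
  by apply/idP/eqP => [/set_mem/atomP[]//|h]; apply: mem_set; apply/atomP.
rewrite !E; move: (atom m.+1 s) => a; rewrite -{1 2}[a]odd_double_half.
move: (odd a) (a./2) => o k; case: o => /=.
  rewrite add1n eqSS; have [->|ik] := eqVneq (i : nat) k.
    rewrite eqxx (_ : (k.*2.+1 == k.*2) = false) ?sub0r//; lia.
  rewrite (_ : (k.*2.+1 == i.*2) = false) ?sub0r; last lia.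
  rewrite (_ : (k.*2 == i.*2) = false) ?oppr0//; lia.
rewrite add0n; have [->|ik] := eqVneq (i : nat) k.
  rewrite eqxx (_ : (k.*2 == k.*2.+1) = false) ?subr0//; lia.
rewrite (_ : (k.*2 == i.*2.+1) = false) ?subr0; last lia.
by rewrite (_ : (k.*2 == i.*2) = false)//; lia.
Qed.

Lemma haar_sum_out (a : dyadic * dyadic -> R) s t :
  ~~ ((0 <= s < 1) && (0 <= t < 1)) -> haar_sum a s t = 0.
Proof.
move=> out; apply: fsbig1 => p _; rewrite !haarE.
by move: out; case: (0 <= s < 1) => //=; [move=> /negbTE->|];
  rewrite ?mulr0 ?mul0r ?mulr0.
Qed.

(** In each variable only one interval of each level contains the given point, so one term remains
    for each pair of levels. *)
Lemma haar_sumE (a : dyadic * dyadic -> R) N s t :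
  (forall p, a p != 0 -> (tag p.1 < N)%N && (tag p.2 < N)%N) ->
  0 <= s < 1 -> 0 <= t < 1 ->
  haar_sum a s t = \sum_(m < N) (\sum_(l < N)
    a (interval_at l (atom l s), interval_at m (atom m t)) *
    (-1) ^+ odd (atom l.+1 s)) * (-1) ^+ odd (atom m.+1 t).
Proof.
move=> aN s01 t01.
pose r := [seq (interval_at l (atom l s), interval_at m (atom m t)) |
           m <- iota 0 N, l <- iota 0 N].
have ur : uniq r.
  apply: allpairs_uniq; rewrite ?iota_uniq// => -[m l] [m' l'] _ _ [-> _ -> _] //.
rewrite /haar_sum -(@fsbig_widen _ _ _ _ [set` r])//; last first.
  move=> p /= [_ pr]; have [->|ap] := eqVneq (a p) 0; first by rewrite mul0r.
  have /andP[p1 p2] := aN _ ap.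
  have [e1|n1] := eqVneq p.1 (interval_at (tag p.1) (atom (tag p.1) s)); last first.
    by rewrite haarE (negbTE n1) andbF mul0r mulr0.
  have [e2|n2] := eqVneq p.2 (interval_at (tag p.2) (atom (tag p.2) t)); last first.
    by rewrite [haar p.2 _]haarE (negbTE n2) andbF !mulr0.
  exfalso; apply: pr; apply/allpairsP; exists (tag p.2, tag p.1).
  by rewrite !mem_iota /= !add0n -e1 -e2; split => //; case: (p).
rewrite -fsbig_seq// big_allpairs_dep -[in iota 0 N](subn0 N) -/(index_iota 0 N) big_mkord.
apply: eq_bigr => m _; rewrite big_mkord mulr_suml; apply: eq_bigr => l _.
by rewrite !haarE s01 t01 /= !eqxx mulrA.
Qed.

End HaarSums.

(** * Coefficient arrays carried by a chain in one variable *)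

Section ChainCoefficients.
Context {R : realType}.
Implicit Types (b : nat -> nat -> nat -> R) (s t : R).

Lemma haar_sum_swap (a : dyadic * dyadic -> R) N s t :
  (forall p, a p != 0 -> (tag p.1 < N)%N && (tag p.2 < N)%N) ->
  haar_sum (fun p => a (p.2, p.1)) s t = haar_sum a t s.
Proof.
move=> aN; have [/andP[s01 t01]|out] := boolP ((0 <= s < 1) && (0 <= t < 1)); last first.
  by rewrite !haar_sum_out// andbC.
rewrite (haar_sumE aN t01 s01) (@haar_sumE _ _ N _ _ _ s01 t01) => [|p /aN /=]; last by rewrite andbC.
under eq_bigr do rewrite mulr_suml.
rewrite exchange_big; apply: eq_bigr => l _; rewrite mulr_suml.
by apply: eq_bigr => m _; rewrite mulrAC.
Qed.

(** The cut-off at level [N] makes the support finite and the function constant on products of atoms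
    of level [N]. *)
Definition chain_coef N b (p : dyadic * dyadic) : R :=
  if [&& tagged p.1 == 0%N :> nat, (tag p.1 < N)%N & (tag p.2 < N)%N]
  then b (tag p.1) (tag p.2) (tagged p.2) else 0.

Lemma chain_coef_supp N b p : chain_coef N b p != 0 ->
  (tag p.1 < N)%N && (tag p.2 < N)%N.
Proof. by rewrite /chain_coef; case: ifP => [/and3P[_ -> ->]|]; rewrite ?eqxx. Qed.

Lemma finite_level_lt N (A : set (dyadic * dyadic)) :
  (forall p, A p -> (tag p.1 < N)%N && (tag p.2 < N)%N) -> finite_set A.
Proof.
move=> AN.
pose D := [seq existT (fun j => 'I_(2 ^ j)) j i | j <- iota 0 N, i <- enum 'I_(2 ^ j)].
have DP (I : dyadic) : (tag I < N)%N -> I \in D.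
  case: I => j i /= jN; apply/allpairsPdep; exists j, i.
  by rewrite mem_iota add0n jN mem_enum.
apply: sub_finite_set (finite_seq [seq (p, q) | p <- D, q <- D]).
move=> [I J] /AN /= /andP[IN JN]; apply/allpairsP; exists (I, J).
by rewrite !DP.
Qed.

(** Summing over the levels of the chain variable first leaves a walk in the other variable, whose
    coefficients are chain walks. The signs of the two variables are [r] and [e]. *)
Lemma haar_sum_chain N b (r e : dyadic -> R) s t : 0 <= s < 1 -> 0 <= t < 1 ->
  haar_sum (fun p => r p.1 * e p.2 * chain_coef N b p) s t =
  hwalk (fun m j => e (interval_at m j) *
    hwalk (chain (fun l => r (interval_at l 0) * b l m j)) N (atom N s))
    N (atom N t).
Proof.
move=> s01 t01; rewrite (@haar_sumE _ _ N)//; last first.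
  move=> p; rewrite mulf_eq0 negb_or => /andP[_]; exact: chain_coef_supp.
have /andP[s0 _] := s01; have /andP[t0 _] := t01.
apply: eq_bigr => m _; rewrite -!atom_div//; last exact: ltnW.
congr (_ * _); rewrite mulr_sumr; apply: eq_bigr => l _.
rewrite -!atom_div//; last exact: ltnW.
rewrite /chain_coef !interval_atK ?atom_lt//= !ltn_ord /chain /= !andbT.
by case: eqP => [->|_] /=; ring.
Qed.

End ChainCoefficients.

(** * Expected absolute values under the signs *)

Section Kernel.
Context {d : measure_display} {T : measurableType d} {R : realType}
  (P : probability T R).
Implicit Types (b : nat -> nat -> nat -> R) (c : bool) (e r : dyadic -> T -> R).

(** The value of E|f| when x is in the atom [i] and y in the atom [i']. The signs of x, almost
    surely 1, are left out; [kernel_chain] justifies this. *)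
Definition kernel e N b i i' : R :=
  expect P (fun w => `|hwalk (fun m j => e (interval_at m j) w *
     hwalk (chain (fun l => b l m j)) N i) N i'|).

Lemma bounded_mfun_kernel c e N (U : nat -> nat -> R) i' : sign_system P c e ->
  bounded_mfun (fun w => `|hwalk (fun m j => e (interval_at m j) w * U m j) N i'|).
Proof.
move=> se; apply/bounded_mfun_norm/bounded_mfun_hwalk => m j.
by apply: bounded_mfunM; [exact: sign_system_mfun se _ | exact: bounded_mfun_cst].
Qed.

Lemma kernel_ge0 e N b i i' : 0 <= kernel e N b i i'.
Proof. exact: expect_ge0. Qed.

Lemma kernelZ c e N b i i' (x : R) : sign_system P c e ->
  kernel e N (fun l m j => x * b l m j) i i' = `|x| * kernel e N b i i'.
Proof.
move=> se; rewrite -expectZ; last exact: (bounded_mfun_kernel _ _ _ se).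
congr expect; apply/funext => w; rewrite -normrM -hwalkZ; congr `|_|.
apply: eq_hwalk => m j _; rewrite mulrCA; congr (_ * _); rewrite -hwalkZ.
by apply: eq_hwalk => l k _; rewrite /chain mulrCA.
Qed.

Lemma kernel_chain r c e N b i i' : sign_system P true r -> sign_system P c e ->
  expect P (fun w => `|hwalk (fun m j => e (interval_at m j) w *
    hwalk (chain (fun l => r (interval_at l 0) w * b l m j)) N i) N i'|) =
  kernel e N b i i'.
Proof.
move=> sr se; apply: eq_expect_ae.
- apply/bounded_mfun_norm/bounded_mfun_hwalk => m j.
  apply: bounded_mfunM; first exact: sign_system_mfun se _.
  apply: bounded_mfun_hwalk => l k; apply: bounded_mfunM; first exact: bounded_mfun_cst.
  by apply: bounded_mfunM; [exact: sign_system_mfun sr _ | exact: bounded_mfun_cst].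
- exact: (bounded_mfun_kernel _ _ _ se).
(* Only countably many signs occur, so they are all equal to 1 outside a single null set. *)
- have : \forall w \ae P, forall l, r (interval_at l 0) w = 1.
    by apply/ae_foralln => l; exact: sign_system_cst sr isT _.
  apply: filterS => w r1; congr `|_|; apply: eq_hwalk => m j _; congr (_ * _).
  by apply: eq_hwalk => l k _; rewrite /chain r1 mul1r.
Qed.

(** Constant signs leave the walk unchanged and the pointwise bound applies. Random signs destroy
    the stopping, but being uncorrelated they give a second moment of at most K^2 + 1 <= (K + 1)^2.
    The same test function thus serves both kinds of signs in y. *)
Lemma expect_hwalk_bounded c e (u : nat -> nat -> R) (K : nat) i :
  sign_system P c e -> (forall m j, `|u m j| <= 1) ->
  `|hwalk u (K ^ 2).+1 i| <= K%:R + 1 ->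
  expect P (fun w => `|hwalk (fun m j => e (interval_at m j) w * u m j) (K ^ 2).+1 i|)
  <= K%:R + 1.
Proof.
move=> se u1 uK; set N := (K ^ 2).+1 in uK *.
have bF := @bounded_mfun_kernel c e N u i se.
case: c se => se.
  rewrite (@eq_expect_ae _ _ _ _ _ (fun=> `|hwalk u N i|)) ?expect_cst//.
    exact: bounded_mfun_cst.
  have : \forall w \ae P, forall m, e (interval_at m (i %/ 2 ^ (N - m))) w = 1.
    by apply/ae_foralln => m; exact: sign_system_cst se isT _.
  apply: filterS => w e1; congr `|_|; apply: eq_bigr => m _.
  by rewrite e1 mul1r.
pose x (m : nat) := u m (i %/ 2 ^ (N - m))%N * (-1) ^+ odd (i %/ 2 ^ (N - m.+1)).
pose E (m : nat) w := e (interval_at m (i %/ 2 ^ (N - m))) w.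
pose F w := \sum_(m < N) E m w * x m.
have FE w : hwalk (fun m j => e (interval_at m j) w * u m j) N i = F w.
  by apply: eq_bigr => m _; rewrite /x mulrA.
have bE m : bounded_mfun (E m) by exact: sign_system_mfun se _.
have bEE m m' : bounded_mfun (fun w => x m * x m' * (E m w * E m' w)).
  by apply: bounded_mfunM; [exact: bounded_mfun_cst | exact: bounded_mfunM].
have F2E : (fun w => F w * F w) =
    (fun w => \sum_(m < N) \sum_(m' < N) x m * x m' * (E m w * E m' w)).
  apply/funext => w; rewrite /F mulr_suml; apply: eq_bigr => m _.
  by rewrite mulr_sumr; apply: eq_bigr => m' _; ring.
have bF2 : bounded_mfun (fun w => F w * F w).
  rewrite F2E; apply: (@bounded_mfun_sum _ _ _ N (fun m w =>
    \sum_(m' < N) x m * x m' * (E m w * E m' w))) => m.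
  exact: (@bounded_mfun_sum _ _ _ N (fun m' w => x m * x m' * (E m w * E m' w))).
have F2 : expect P (fun w => F w * F w) <= N%:R.
  rewrite F2E (@expect_sum _ _ _ P N (fun m w =>
    \sum_(m' < N) x m * x m' * (E m w * E m' w))); last first.
    by move=> m; exact: (@bounded_mfun_sum _ _ _ N (fun m' w => x m * x m' * (E m w * E m' w))).
  apply: (@le_trans _ _ (\sum_(m < N) 1)); last by rewrite sumr_const card_ord.
  apply: ler_sum => m _.
  rewrite (@expect_sum _ _ _ P N (fun m' w => x m * x m' * (E m w * E m' w)))//.
  rewrite (bigD1 m)//= big1 => [|m' m'm].
    rewrite addr0 expectZ; last exact: bounded_mfunM.
    rewrite (_ : (fun w => E m w * E m w) = fun=> 1); last first.
      by apply/funext => w; rewrite normr1_sqr// (sign_system_norm se).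
    rewrite expect_cst mulr1 -expr2 -real_normK ?num_real// expr_le1//.
    by rewrite normrM normr_sign mulr1.
  rewrite expectZ; last exact: bounded_mfunM.
  rewrite (sign_system_uncorrelated se)// ?mulr0//.
  by apply: contra_neq m'm => -[mm' _]; apply: val_inj.
have K0 : 0 < K%:R + 1 :> R by rewrite ltr_wpDl.
(* In place of Cauchy-Schwarz: |F| <= F^2 / (2 A) + A / 2 with A = K + 1. *)
have bR : bounded_mfun (fun w => (2 * (K%:R + 1))^-1 * (F w * F w) + (K%:R + 1) / 2).
  apply: bounded_mfunD; last exact: bounded_mfun_cst.
  by apply: bounded_mfunM => //; exact: bounded_mfun_cst.
apply: le_trans (le_expect P bF bR _) _ => [w|].
  rewrite FE -[F w * F w]/(F w ^+ 2) -real_normK ?num_real//.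
  set y := `|F w|; rewrite -subr_ge0.
  rewrite (_ : _ - y = (2 * (K%:R + 1))^-1 * (y - (K%:R + 1)) ^+ 2).
    by rewrite mulr_ge0 ?sqr_ge0// invr_ge0 mulr_ge0// ltW.
  by field; rewrite gt_eqF.
rewrite expectD; [|by apply: bounded_mfunM => //; exact: bounded_mfun_cst|exact: bounded_mfun_cst].
rewrite expect_cst expectZ//.
have : (2 * (K%:R + 1))^-1 * expect P (fun w => F w * F w) <= (K%:R + 1) / 2.
  rewrite ler_pdivrMl ?mulr_gt0//.
  apply: le_trans F2 _; rewrite /N -natr1 natrX.
  have : 0 <= K%:R :> R by []. nra.
lra.
Qed.

End Kernel.

(** * Iterated norms of step functions of two variables *)

Section MixedNorm.
Context {R : realType} (X Y : haar_system_space R).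
Implicit Types (K : nat -> nat -> R) (b : nat -> nat -> nat -> R).

Definition mixed_norm N K : R := snorm X N (fun i => snorm Y N (K i)).

Lemma mixed_normZ N K x : mixed_norm N (fun i j => x * K i j) = `|x| * mixed_norm N K.
Proof.
rewrite /mixed_norm -[in RHS]normr_id -snormZ.
by apply: eq_snorm => i _; rewrite snormZ.
Qed.

Lemma mixed_norm_stepf (F : R -> R -> R) N K :
  (forall s t, 0 <= s < 1 -> 0 <= t < 1 -> F s t = K (atom N s) (atom N t)) ->
  (forall s t, ~~ ((0 <= s < 1) && (0 <= t < 1)) -> F s t = 0) ->
  X (fun s => Y (F s)) = mixed_norm N K.
Proof.
move=> FK F0; congr (X _); apply/funext => s; rewrite /stepf.
have [s01|s01] := boolP (0 <= s < 1).
  congr (Y _); apply/funext => t; rewrite /stepf.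
  case: (boolP (0 <= t < 1)) => t01; first exact: FK.
  by rewrite F0// negb_and t01 orbT.
rewrite -[RHS](@normr0 R R) -(snorm_cst Y 0 0); congr (Y _); apply/funext => t.
have -> : F s t = 0 by apply: F0; rewrite negb_and s01.
by rewrite /stepf; case: ifP.
Qed.

Lemma ler_mixed_norm_cst N K A :
  (forall i j, (i < 2 ^ N)%N -> (j < 2 ^ N)%N -> `|K i j| <= A) ->
  mixed_norm N K <= A.
Proof.
move=> KA; apply: snorm_le_cst => i iN; rewrite ger0_norm ?snorm_ge0//.
by apply: snorm_le_cst => j jN; exact: KA.
Qed.

Lemma avg_le_mixed_norm N K :
  avg N (fun i => avg N (fun j => `|K i j|)) <= mixed_norm N K.
Proof.
apply: le_trans (avg_le_snorm _ _ _); apply: le_avg => i _.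
by rewrite ger0_norm ?snorm_ge0// avg_le_snorm.
Qed.

End MixedNorm.

(** * The norm of Z and the Capon projection on chain arrays *)

Section ChainNorms.
Context {R : realType} (P : probability (signs * signs)%type R)
  (X Y : haar_system_space R).
Implicit Types (b : nat -> nat -> nat -> R).

Lemma Z_norm_chain1 c N b :
  sign_system P true (fun I w => sign_of R w.1 I) ->
  sign_system P c (fun I w => sign_of R w.2 I) ->
  Z_norm P X Y (chain_coef N b) =
  mixed_norm X Y N (kernel P (fun I w => sign_of R w.2 I) N b).
Proof.
move=> s1 s2; apply: mixed_norm_stepf => s t.
  move=> s01 t01; rewrite -(kernel_chain _ _ _ _ s1 s2) /expect; congr (fine ('E_P[_])%E).
  by apply/funext => w; rewrite (haar_sum_chain _ _ (fun I => sign_of R w.1 I)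
    (fun I => sign_of R w.2 I)).
move=> out; rewrite -[RHS](expect_cst P); congr (fine ('E_P[_])%E).
by apply/funext => w; rewrite haar_sum_out// normr0.
Qed.

(** The chain now lies in the second variable, so the array is transposed and the kernel takes its
    arguments in reverse order. *)
Lemma Z_norm_chain2 c N b :
  sign_system P c (fun I w => sign_of R w.1 I) ->
  sign_system P true (fun I w => sign_of R w.2 I) ->
  Z_norm P X Y (fun p => chain_coef N b (p.2, p.1)) =
  mixed_norm X Y N (fun i j => kernel P (fun I w => sign_of R w.1 I) N b j i).
Proof.
move=> s1 s2; apply: mixed_norm_stepf => s t.
  move=> s01 t01; rewrite -(kernel_chain _ _ _ _ s2 s1) /expect; congr (fine ('E_P[_])%E).
  apply/funext => w; congr `|_|.
  rewrite -(haar_sum_chain _ _ (fun I => sign_of R w.2 I) (fun I => sign_of R w.1 I))//.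
  rewrite -(@haar_sum_swap _ (fun p => sign_of R w.2 p.1 * sign_of R w.1 p.2 *
    chain_coef N b p) N) => [|p]; last first.
    by rewrite mulf_eq0 negb_or => /andP[_]; exact: chain_coef_supp.
  by congr (haar_sum _ s t); apply/funext => p /=; rewrite [X in X * _]mulrC.
move=> out; rewrite -[RHS](expect_cst P); congr (fine ('E_P[_])%E).
by apply/funext => w; rewrite haar_sum_out// normr0.
Qed.

Lemma dlen_le (I J : dyadic) : (dlen I <= dlen J :> R) = (tag J <= tag I)%N.
Proof.
by rewrite /dlen lef_pV2 ?posrE ?exprn_gt0// ler_eXn2l// ltr1n.
Qed.

(** Shorter intervals have larger levels: the projection keeps m <= l when the chain is in the first
    variable, and l <= m when it is in the second. *)
Lemma capon_chain1 N b : capon (chain_coef N b) =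
  chain_coef N (fun l m j => if (m <= l)%N then b l m j else 0).
Proof.
apply/funext => p; rewrite /capon /chain_coef dlen_le.
by case: ifP => //; case: ifP.
Qed.

Lemma capon_chain2 N b : capon (fun p => chain_coef N b (p.2, p.1)) =
  fun p => chain_coef N (fun l m j => if (l <= m)%N then b l m j else 0) (p.2, p.1).
Proof.
apply/funext => p; rewrite /capon /chain_coef dlen_le /=.
by case: ifP => //; case: ifP.
Qed.

Lemma V2_chain_coef N b : V2 R (chain_coef N b).
Proof. by apply: (@finite_level_lt N) => p /= /chain_coef_supp. Qed.

Lemma V2_chain_coef_swap N b : V2 R (fun p => chain_coef N b (p.2, p.1)).
Proof.
apply: (@finite_level_lt N) => p /= /chain_coef_supp /=.
by rewrite andbC.
Qed.

Lemma capon_unboundedP :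
  (forall L : R, exists2 a, V2 R a /\ Z_norm P X Y a <= 1 & L <= Z_norm P X Y (capon a)) ->
  capon_unbounded P X Y.
Proof.
move=> h; apply/eqyP => L L0; have [a aV aL] := h L.
apply: (@le_trans _ _ (Z_norm P X Y (capon a))%:E); first by rewrite lee_fin.
by apply: ereal_sup_ubound; exists a.
Qed.

End ChainNorms.

(** * The two test functions *)

Section Unboundedness.
Context {d : measure_display} {T : measurableType d} {R : realType}
  (P : probability T R) (c : bool) (e : dyadic -> T -> R)
  (se : sign_system P c e).
Implicit Types (b : nat -> nat -> nat -> R) (up : bool).

Definition truncated up b l m j : R :=
  if (if up then m <= l else l <= m)%N then b l m j else 0.

(** [Phi] stands for the mixed norm with the variables in either order, so that both cases of the
    theorem share the arguments below. [B] bounds the norm of f, which is normalised only at the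
    end. *)
Definition kernel_unbounded up (Phi : nat -> (nat -> nat -> R) -> R) :=
  forall L : R, exists N b B, [/\ 0 < B, Phi N (kernel P e N b) <= B &
    L * B <= Phi N (kernel P e N (truncated up b))].

Lemma exists_nat_ge (x : R) : exists K : nat, (0 < K)%N /\ x <= K%:R.
Proof.
exists (Num.truncn x).+1; split => //.
by apply: ltW; exact: truncnS_gt.
Qed.

(** The first condition on [Phi] combines L^1 in x with the supremum in y; the second is domination
    of the L^1 norm on the square. *)
Lemma kernel_unbounded_L1 up Phi (C : R) : 0 < C ->
  (forall N K G A, 0 <= A -> (forall i, 0 <= G i) ->
     (forall i j, (i < 2 ^ N)%N -> (j < 2 ^ N)%N -> `|K i j| <= G i * A) ->
     Phi N K <= C * (avg N G * A)) ->
  (forall N K, avg N (fun i => avg N (fun j => `|K i j|)) <= Phi N K) ->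
  kernel_unbounded up Phi.
Proof.
move=> C0 hU hL L.
(* With this choice, L times the bound 2C(K + 1) for f is at most K(K + 1)/16 <= K^2/8, the lower
   bound reached for the truncated function. *)
have [K [K0 hK]] := exists_nat_ge (32 * `|L| * C).
(* The extra level is needed when [up] is false: level m of the walk is then seen on block m + 1. *)
pose M : R := K%:R; pose N := (K ^ 2).+1; pose one (_ _ : nat) : R := 1.
have one1 m j : `|one m j| = 1 by rewrite normr1.
have M1 : 1 <= M by rewrite ler1n.
pose w := alive M one.
have w01 m j : (w m j == 0) || (w m j == 1).
  by rewrite /w /alive; case: (_ <= _); rewrite ?eqxx ?orbT.
pose b l m j := 2 ^+ l * w m j.
pose g i := `|hwalk (chain (fun l => 2 ^+ l)) N i| : R.
exists N, b, (C * (2 * (M + 1))); split.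
- by rewrite !mulr_gt0// ltr_wpDl// ler0n.
- apply: le_trans (hU _ _ g (M + 1) _ _ _) _.
  + by rewrite addr_ge0// ler0n.
  + by move=> i; exact: normr_ge0.
  + move=> i j _ _; rewrite ger0_norm ?kernel_ge0//.
    rewrite /kernel (_ : (fun _ => _) = (fun v => g i *
        `|hwalk (fun m k => e (interval_at m k) v * w m k) N j|)).
      rewrite expectZ; last exact: (bounded_mfun_kernel _ _ _ se).
      rewrite ler_wpM2l ?normr_ge0//; apply: (expect_hwalk_bounded se).
        by move=> m k; have /orP[/eqP->|/eqP->] := w01 m k; rewrite ?normr0 ?normr1.
      rewrite (@eq_hwalk _ _ (fun m j => alive M one m j * one m j)).
        by rewrite hwalk_stopped; apply: stopped_bound => //; rewrite ler0n.
      by move=> m k _; rewrite mulr1.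
    apply/funext => v; rewrite /g -normrM -hwalkZ; congr `|_|.
    apply: eq_hwalk => m k _; rewrite mulrCA; congr (_ * _).
    rewrite mulrC -hwalkZ; apply: eq_hwalk => l i0 _; rewrite /chain /b; ring.
  + by rewrite ler_pM2l// ler_wpM2r ?avg_chain_pow// addr_ge0// ler0n.
- apply: le_trans (hL _ _).
  pose Q i m := hwalk (chain (fun l => if (if up then m <= l else l <= m)%N
                                       then 2 ^+ l else 0)) N i : R.
  (* For each outcome, [avg_hwalk_ge_level] applies with the signs of y as its [s]. The resulting
     bound is free of the signs, so it passes to the expectation. *)
  have lower i m0 : (m0 < N)%N -> `|Q i m0| * avg m0 (w m0) <=
      avg N (fun j => `|kernel P e N (truncated up b) i j|).
    move=> m0N.
    pose F j v := `|hwalk (fun m k => e (interval_at m k) v * (Q i m * w m k)) N j|.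
    have bF j : bounded_mfun (F j) by exact: (bounded_mfun_kernel _ (fun m k => Q i m * w m k) _ se).
    rewrite (@eq_avg _ N _ (fun j => expect P (F j))) ?avg_expect//.
      apply: expect_ge_cst.
        by apply: bounded_mfunM; [exact: bounded_mfun_cst | exact: bounded_mfun_sum].
      move=> v; apply: (@avg_hwalk_ge_level _ (Q i) w (fun m k => e (interval_at m k) v)) => //.
      by move=> m j; exact: sign_system_norm se _ _.
    move=> j _; rewrite ger0_norm ?kernel_ge0//; congr expect; apply/funext => v.
    congr `|_|; apply: eq_hwalk => m k _; congr (_ * _).
    rewrite mulrC -hwalkZ; apply: eq_hwalk => l i0 _; rewrite /chain /truncated /b.
    by case: ifP => _; ring.
  have w0 m : 0 <= avg m (w m) by apply: avg_ge0 => i _; exact: alive_ge0.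
  (* Contribution of block k, of measure 2^-(k+1): the coefficient has size 2^k at level k if [up],
     and otherwise 2^k - 1 >= 2^(k-1) at level k - 1. *)
  pose H k : R := if up then 2^-1 * avg k (w k) else
    if k is k'.+1 then 4^-1 * avg k' (w k') else 0.
  apply: (@le_trans _ _ (4^-1 * \sum_(m < K ^ 2) avg m (w m))).
    have := sum_alive one1 K0 (leqnn (K ^ 2)); rewrite -/M -/w.
    have : L * (C * (2 * (M + 1))) <= M * (M + 1) / 16.
      have -> : L * (C * (2 * (M + 1))) = (32 * L * C) * (M + 1) / 16 by field.
      rewrite ler_pM2r// ler_pM2r; last by lra.
      apply: le_trans hK; rewrite ler_pM2r// ler_pM2l//; exact: ler_norm.
    have : M * (M + 1) / 16 <= M ^+ 2 / 8 by nra.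
    lra.
  apply: (@le_trans _ _ (\sum_(k < N) 2 ^+ k.+1 * H k / 2 ^+ k.+1)).
    rewrite [leRHS](eq_bigr (fun k : 'I_N => H k)); last first.
      by move=> k _; rewrite mulrC mulKf// gt_eqF// exprn_gt0.
    rewrite mulr_sumr /H; case: up {Q lower H}.
      rewrite big_ord_recr /= -[leLHS]addr0; apply: lerD.
        by apply: ler_sum => m _; rewrite ler_wpM2r// lef_pV2 ?posrE// ler_nat.
      by apply: mulr_ge0 (w0 _).
    by rewrite big_ord_recl /= add0r.
  apply: (avg_ge_blocks (G := fun k => 2 ^+ k.+1 * H k)) => [i _|k i kN iN ik]; first exact: avg_ge0.
  rewrite /H /=; case: ifP => upE.
    have := lower i k kN; rewrite /Q upE; apply: le_trans.
    rewrite (@chain_pow_up _ _ k)// normrN ger0_norm ?exprn_ge0//.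
    by rewrite mulrA exprSr mulfK.
  case: k kN ik => [|k] kN ik; first by rewrite mulr0; exact: avg_ge0.
  have := lower i k (ltnW kN); rewrite /Q upE; apply: le_trans.
  rewrite (@chain_pow_low _ _ k.+1)// mulrA ler_wpM2r//.
  have p1 : 1 <= 2 ^+ k :> R by rewrite exprn_ege1// ler1n.
  apply: le_trans (ler_norm _).
  rewrite !exprS; lra.
Qed.

(** The conditions on [Phi] are domination by the supremum and a lower bound by the L^1 norm in y
    over the atom of x at 0. *)
Lemma kernel_unbounded_Linfty up Phi (x : R) : 0 < x ->
  (forall N K A,
     (forall i j, (i < 2 ^ N)%N -> (j < 2 ^ N)%N -> `|K i j| <= A) ->
     Phi N K <= A) ->
  (forall N K, x * avg N (fun j => `|K 0%N j|) <= Phi N K) ->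
  kernel_unbounded up Phi.
Proof.
move=> x0 hU hL L.
(* The lower bound x K^2 / (8 (K + 1)) >= x K / 16 has to reach 2 L, where 2 bounds f. *)
have [K [K0 hK]] := exists_nat_ge (32 * `|L| / x).
pose M : R := K%:R; pose N := (K ^ 2).+1.
have M1 : 1 <= M by rewrite ler1n.
pose sh := (~~ up : nat).
pose b l m (_ : nat) := shifted_bump N sh m l : R.
exists N, b, 2; split => //.
- apply: hU => i j iN _; rewrite ger0_norm ?kernel_ge0//.
  apply: expect_le_cst; first exact: (bounded_mfun_kernel _ _ _ se).
  move=> v; apply: le_trans (le_abs_hwalk _ _ _) _.
  apply: le_trans (sum_shifted_bump sh iN).
  by apply: ler_sum => m _; rewrite normrM (sign_system_norm se) mul1r.
- apply: le_trans (hL _ _).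
  pose q m : R := `|\sum_(l < N) truncated up b l m 0|.
  pose sg : R := if up then -1 else 1.
  have sgn : `|sg| = 1 by rewrite /sg; case: (up); rewrite ?normrN normr1.
  (* At x = 0 the kept coefficients all have the sign [sg]: if [up], only -1/2 at l = m remains;
     otherwise the terms 2^(l-m-2) with l <= m do, and the one at l = m is already 1/4. *)
  have sum_q m : \sum_(l < N) truncated up b l m 0 = sg * q m /\
      ((m < K ^ 2)%N -> 4^-1 <= q m).
    have tE l : truncated up b l m 0 = if up then
        (if (l == m)%N && (m < N)%N then - 2^-1 else 0) else
        (if (l <= m)%N && (m.+1 < N)%N then (2 ^+ m.+2)^-1 * 2 ^+ l else 0).
      rewrite /truncated /b /shifted_bump /bump /sh; case: (up) => /=.
        rewrite addn0; by case: (ltngtP l m) => //= _; case: (m < N)%N.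
      rewrite addn1; case: (leqP l m) => //= lm; case: (m.+1 < N)%N => //=.
      by rewrite ltnS lm.
    have t0 l : 0 <= sg * truncated up b l m 0.
      rewrite tE /sg; case: (up) => /=; case: ifP => _; rewrite ?mulr0//.
    have sg2 : sg * sg = 1 by exact: normr1_sqr.
    have qE : q m = sg * \sum_(l < N) truncated up b l m 0.
      rewrite mulr_sumr -[RHS]ger0_norm; last by apply: sumr_ge0 => l _; exact: t0.
      by rewrite -mulr_sumr normrM sgn mul1r.
    split; first by rewrite qE mulrA sg2 mul1r.
    move=> mK; have mN : (m < N)%N by rewrite ltnS ltnW.
    rewrite qE mulr_sumr (bigD1 (Ordinal mN))//=.
    apply: (@le_trans _ _ (sg * truncated up b m m 0)); last first.
      by rewrite lerDl; apply: sumr_ge0 => l _; exact: t0.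
    rewrite tE eqxx leqnn mN ltnS mK /sg; case: (up) => /=; first by lra.
    rewrite mul1r !exprS; have := exprn_gt0 m (ltr0Sn R 1) => p0.
    by rewrite !invfM mulrA mulfVK ?gt_eqF//; lra.
  pose F j v := `|hwalk (fun m k => e (interval_at m k) v * q m) N j|.
  have bF j : bounded_mfun (F j) by exact: (bounded_mfun_kernel _ (fun m k => q m) _ se).
  rewrite (@eq_avg _ N _ (fun j => expect P (F j))); last first.
    move=> j _; rewrite ger0_norm ?kernel_ge0//; congr expect; apply/funext => v.
    rewrite /F (@eq_hwalk _ _ (fun m k => sg * (e (interval_at m k) v * q m))).
      by rewrite hwalkZ normrM sgn mul1r.
    by move=> m k _; rewrite hwalk_chain0 (sum_q m).1 mulrCA.
  rewrite avg_expect//.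
  have : M ^+ 2 / 8 / (M + 1) <= expect P (fun v => avg N (fun j => F j v)).
    apply: expect_ge_cst.
      by apply: bounded_mfunM; [exact: bounded_mfun_cst | exact: bounded_mfun_sum].
    move=> v; rewrite ler_pdivrMr; last by lra.
    rewrite [leRHS]mulrC.
    apply: (@avg_hwalk_ge_stopped _ q (fun m k => e (interval_at m k) v) K N) => //.
    + by move=> m j; exact: sign_system_norm se _ _.
    + by move=> m; exact: normr_ge0.
    + by move=> m; exact: (sum_q m).2.
  set E := expect _ _ => hE.
  have h1 : M / 16 <= E.
    apply: le_trans hE; rewrite ler_pdivlMr; last by lra.
    nra.
  have h2 : 32 * L / x <= M.
    by apply: le_trans hK; rewrite ler_pM2r ?invr_gt0// ler_pM2l// ler_norm.
  rewrite ler_pdivrMr// in h2.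
  nra.
Qed.

End Unboundedness.

(** * Conclusion for the two variables *)

Theorem theorem2p10 (R : realType) (c1 c2 : bool)
    (P : probability (signs * signs)%type R) (hP : is_haar_measure c1 c2 P)
    (X Y : haar_system_space R)
    (hXY : (c1 = true /\ (equiv_Lp X 1%E \/ equiv_Lp X +oo%E)) \/
           (c2 = true /\ (equiv_Lp Y 1%E \/ equiv_Lp Y +oo%E))) :
  capon_unbounded P X Y.
Proof.
have [s1 s2] := haar_measure_signs hP.
apply: capon_unboundedP => L.
case: hXY => -[cE hLp].
- rewrite cE in s1; pose e2 I (w : signs * signs) := sign_of R w.2 I.
  have [N [b [B [B0 hB hL]]]] : exists N b B, [/\ 0 < B,
      mixed_norm X Y N (kernel P e2 N b) <= B &
      L * B <= mixed_norm X Y N (kernel P e2 N (truncated true b))].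
    case: hLp => [/equiv_L1_snorm[C C0 hC]|/equiv_Linf_snorm[x x0 hx]].
      apply: (@kernel_unbounded_L1 _ _ _ _ _ _ s2 true (mixed_norm X Y) C C0 _
        (@avg_le_mixed_norm _ X Y)).
      move=> N K G A A0 G0 KG; apply: le_trans (hC _ _) _.
      rewrite ler_pM2l// mulrC -avgZ; apply: le_avg => i iN.
      rewrite ger0_norm ?snorm_ge0// mulrC.
      by apply: snorm_le_cst => j jN; exact: KG.
    apply: (@kernel_unbounded_Linfty _ _ _ _ _ _ s2 true (mixed_norm X Y) x x0
      (@ler_mixed_norm_cst _ X Y)).
    move=> N K; apply: le_trans (hx _ _); rewrite ler_pM2l//.
    by rewrite ger0_norm ?snorm_ge0// avg_le_snorm.
  (* Dividing the coefficients by [B] brings the norm of f to at most 1 and keeps that of its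
     projection at least [L]. *)
  have B1 : `|B^-1| * B = 1 by rewrite ger0_norm ?invr_ge0 ?ltW// mulVf// gt_eqF.
  have Bi : 0 < `|B^-1| by rewrite normr_gt0 invr_eq0 gt_eqF.
  have scale b' : Z_norm P X Y (chain_coef N (fun l m j => B^-1 * b' l m j)) =
      `|B^-1| * mixed_norm X Y N (kernel P e2 N b').
    rewrite (Z_norm_chain1 _ _ _ _ s1 s2) -[`|_|]normr_id -mixed_normZ.
    by congr mixed_norm; apply/funext => i; apply/funext => j; rewrite (kernelZ _ _ _ _ _ s2).
  exists (chain_coef N (fun l m j => B^-1 * b l m j)).
    by split; [exact: V2_chain_coef | rewrite scale -B1 ler_pM2l].
  rewrite capon_chain1 (_ : (fun _ _ _ => _) =
      (fun l m j => B^-1 * truncated true b l m j)); last first.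
    by apply/funext => l; apply/funext => m; apply/funext => j;
      rewrite /truncated; case: ifP; rewrite ?mulr0.
  by rewrite scale -[L]mulr1 -B1 mulrCA ler_pM2l.
- rewrite cE in s2; pose e1 I (w : signs * signs) := sign_of R w.1 I.
  have [N [b [B [B0 hB hL]]]] : exists N b B, [/\ 0 < B,
      mixed_norm X Y N (fun i j => kernel P e1 N b j i) <= B &
      L * B <= mixed_norm X Y N (fun i j => kernel P e1 N (truncated false b) j i)].
    case: hLp => [/equiv_L1_snorm[C C0 hC]|/equiv_Linf_snorm[x x0 hx]].
      apply: (@kernel_unbounded_L1 _ _ _ _ _ _ s1 false
        (fun N K => mixed_norm X Y N (fun i j => K j i)) C C0).
        move=> N K G A A0 G0 KG; apply: snorm_le_cst => i iN.
        rewrite ger0_norm ?snorm_ge0//; apply: le_trans (hC _ _) _.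
        rewrite ler_pM2l// mulrC -avgZ; apply: le_avg => j jN.
        by rewrite mulrC; exact: KG.
      (* The chain variable is now the inner one, so the two averages are exchanged. *)
      move=> N K; apply: le_trans (avg_le_mixed_norm _ _ _ _).
      rewrite /avg -!mulr_sumr ler_pM2l ?invr_gt0 ?exprn_gt0//.
      by rewrite ler_pM2l ?invr_gt0 ?exprn_gt0// exchange_big.
    apply: (@kernel_unbounded_Linfty _ _ _ _ _ _ s1 false
        (fun N K => mixed_norm X Y N (fun i j => K j i)) x x0).
      by move=> N K A KA; apply: ler_mixed_norm_cst => i j iN jN; exact: KA.
    (* The outer norm is bounded below by that of L^1, and the inner one by the value at the atom
       0. *)
    move=> N K; apply: le_trans (avg_le_snorm _ _ _); rewrite -avgZ.
    apply: le_avg => i iN; rewrite [leRHS]ger0_norm ?snorm_ge0//.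
    exact: (hx _ (fun j => K j i)).
  have B1 : `|B^-1| * B = 1 by rewrite ger0_norm ?invr_ge0 ?ltW// mulVf// gt_eqF.
  have Bi : 0 < `|B^-1| by rewrite normr_gt0 invr_eq0 gt_eqF.
  have scale b' : Z_norm P X Y (fun p => chain_coef N (fun l m j => B^-1 * b' l m j) (p.2, p.1)) =
      `|B^-1| * mixed_norm X Y N (fun i j => kernel P e1 N b' j i).
    rewrite (Z_norm_chain2 _ _ _ _ s1 s2) -[`|_|]normr_id -mixed_normZ.
    by congr mixed_norm; apply/funext => i; apply/funext => j; rewrite (kernelZ _ _ _ _ _ s1).
  exists (fun p => chain_coef N (fun l m j => B^-1 * b l m j) (p.2, p.1)).
    by split; [exact: V2_chain_coef_swap | rewrite scale -B1 ler_pM2l].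
  rewrite capon_chain2 (_ : (fun _ _ _ => _) =
      (fun l m j => B^-1 * truncated false b l m j)); last first.
    by apply/funext => l; apply/funext => m; apply/funext => j;
      rewrite /truncated; case: ifP; rewrite ?mulr0.
  by rewrite scale -[L]mulr1 -B1 mulrCA ler_pM2l.
Qed.
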